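(* Let $\mathcal{C}$ be a quasicategory equipped with a distinguished class of morphisms called cofibrations, denoted $\rightarrowtail$. Suppose that all pushouts along cofibrations exist in $\mathcal{C}$ and that all identity morphisms in $\mathcal{C}$ are cofibrations (no Waldhausen axioms are assumed). Then there exists a map $\mathcal{C}^{\mathcal{I}}_{co}\to\mathcal{C}^{\mathcal{J}}_{co,po}$ which is a functorial choice of pushouts along cofibrations that preserves identity morphisms. More precisely, there is a map $F\colon\mathcal{C}^{\mathcal{I}}_{co}\to\mathcal{C}^{\mathcal{J}}_{co,po}$ such that $\mathrm{res}_{po}\circ F=\mathrm{Id}_{\mathcal{C}^{\mathcal{I}}_{co}}$ and the restriction of $F$ to $\mathcal{C}^{\mathcal{I}}_{\mathrm{Id}}\subseteq\mathcal{C}^{\mathcal{I}}_{co}$ is the map ''id ext'' $\colon\mathcal{C}^{\mathcal{I}}_{\mathrm{Id}}\to\mathcal{C}^{\mathcal{J}}_{co,po}$.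
   Context: Identity morphisms are the degenerate 1-simplices. A simplicial subset is 0-full if a simplex belongs to it exactly when all its vertices do. $\mathcal{J}=\Delta[1]\times\Delta[1]$ is the nerve of the free-standing commutative square, and $\mathcal{I}\subseteq\mathcal{J}$ is the nerve of the subcategory determined by the top horizontal map and the left vertical map. $\mathcal{C}^{\mathcal{I}}_{co}$ is the 0-full sub quasicategory of $\mathcal{C}^{\mathcal{I}}$ on the diagrams $C_3\leftarrowtail C_1\to C_2$ with left vertical map $C_1\to C_3$ a cofibration; $\mathcal{C}^{\mathcal{J}}_{co}$ is the 0-full sub quasicategory of $\mathcal{C}^{\mathcal{J}}$ on the squares with left vertical map a cofibration; $\mathcal{C}^{\mathcal{J}}_{co,po}\subseteq\mathcal{C}^{\mathcal{J}}_{co}$ is 0-full on the pushout squares; $\mathrm{res}_{po}\colon\mathcal{C}^{\mathcal{J}}_{co,po}\to\mathcal{C}^{\mathcal{I}}_{co}$ is restriction along $\mathcal{I}\hookrightarrow\mathcal{J}$. $\mathcal{C}^{\Delta[1]}_{co}\subseteq\mathcal{C}^{\Delta[1]}$ is 0-full on the cofibrations. $\mathcal{C}^{\mathcal{I}}_{\mathrm{Id}}$ is the simplicial subset of $\mathcal{C}^{\mathcal{I}}_{co}$ that is the union of the images of the maps $\mathcal{C}^{\Delta[1]}\to\mathcal{C}^{\mathcal{I}}_{co}$, $f\mapsto(\overset{\mathrm{Id}}{\leftarrowtail}\ \overset{f}{\rightarrow})$ (left vertical map identity, top horizontal map $f$), and $\mathcal{C}^{\Delta[1]}_{co}\to\mathcal{C}^{\mathcal{I}}_{co}$,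 $g\mapsto(\overset{g}{\leftarrowtail}\ \overset{\mathrm{Id}}{\rightarrow})$ (left vertical map $g$, top horizontal map identity). The map ''id ext'' extends the first kind of diagram to the degenerate square with both horizontal maps $f$ and both vertical maps identities, and the second kind to the degenerate square with both vertical maps $g$ and both horizontal maps identities (on simplices, by precomposition with the two projections $\Delta[1]\times\Delta[1]\to\Delta[1]$). *)

(* Defs.v *)
From HB Require Import structures.
From mathcomp Require Import all_boot.
From mathcomp Require Import boolp.

Set Implicit Arguments.
Unset Strict Implicit.
Unset Printing Implicit Defensive.

(* [mono m n] is the set of weakly monotone maps [m] -> [n], where
   [n] = {0 < ... < n} is the ordinal type 'I_n.+1. *)
Definition is_mono m n (f : {ffun 'I_m.+1 -> 'I_n.+1}) : bool :=
  [forall i : 'I_m.+1, forall j : 'I_m.+1, (i <= j) ==> (f i <= f j)].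

Record mono m n := Mono {
  mono_fun :> {ffun 'I_m.+1 -> 'I_n.+1};
  _ : is_mono mono_fun }.

HB.instance Definition _ m n := [isSub for @mono_fun m n].

Lemma mono_le m n (f : mono m n) (i j : 'I_m.+1) : i <= j -> f i <= f j.
Proof. by case: f => f /= /forallP/(_ i)/forallP/(_ j)/implyP; apply. Qed.

Lemma mono_eq m n (f g : mono m n) : (forall i, f i = g i) -> f = g.
Proof. by move=> fg; apply/val_inj/ffunP. Qed.

Lemma mono_subproof m n (f : 'I_m.+1 -> 'I_n.+1) :
  (forall i j : 'I_m.+1, i <= j -> f i <= f j) -> is_mono (finfun f).
Proof.
move=> fP; apply/forallP => i; apply/forallP => j; apply/implyP.
by rewrite !ffunE; apply: fP.
Qed.

Definition mkmono m n (f : 'I_m.+1 -> 'I_n.+1)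
    (fP : forall i j : 'I_m.+1, i <= j -> f i <= f j) : mono m n :=
  Mono (mono_subproof fP).

Definition mid n : mono n n := @mkmono n n id (fun _ _ ij => ij).

Definition mcomp m n p (g : mono n p) (f : mono m n) : mono m p :=
  @mkmono m p (fun i => g (f i)) (fun _ _ ij => mono_le g (mono_le f ij)).

Definition mconst m n (c : 'I_n.+1) : mono m n :=
  @mkmono m n (fun _ => c) (fun _ _ _ => leqnn c).

Lemma mkmonoE m n f fP i : @mkmono m n f fP i = f i.
Proof. by rewrite ffunE. Qed.

Lemma midE n i : mid n i = i. Proof. exact: mkmonoE. Qed.

Lemma mcompE m n p (g : mono n p) (f : mono m n) i : mcomp g f i = g (f i).
Proof. exact: mkmonoE. Qed.

Lemma mconstE m n c i : @mconst m n c i = c.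
Proof. exact: mkmonoE. Qed.

Lemma mcompA m n p q (h : mono p q) (g : mono n p) (f : mono m n) :
  mcomp (mcomp h g) f = mcomp h (mcomp g f).
Proof. by apply: mono_eq => i; rewrite !mcompE. Qed.

Lemma mcomp1 m n (f : mono m n) : mcomp f (mid m) = f.
Proof. by apply: mono_eq => i; rewrite mcompE midE. Qed.

Lemma mcomp_const m n p (c : 'I_p.+1) (f : mono m n) :
  mcomp (mconst n c) f = mconst m c.
Proof. by apply: mono_eq => i; rewrite mcompE !mconstE. Qed.

Lemma mcomp_constr m n p (c : 'I_n.+1) (f : mono n p) :
  mcomp f (mconst m c) = mconst m (f c).
Proof. by apply: mono_eq => i; rewrite mcompE !mconstE. Qed.

Lemma mono0E m (f : mono m 0) : f = mconst m ord0.
Proof. by apply: mono_eq => i; rewrite !ord1. Qed.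

Record sSet := SSet {
  simplex :> nat -> Type;
  act : forall m n, mono m n -> simplex n -> simplex m;
  act_id : forall n (x : simplex n), act (mid n) x = x;
  act_comp : forall m n p (f : mono m n) (g : mono n p) (x : simplex p),
    act (mcomp g f) x = act f (act g x) }.
Arguments act {s m n}.

Record smap (X Y : sSet) := SMap {
  sfun :> forall n, X n -> Y n;
  sfun_act : forall m n (f : mono m n) (x : X n),
    sfun (act f x) = act f (sfun x) }.
Arguments SMap {X Y}.
Arguments sfun {X Y} _ {n}.

Lemma smap_eq (X Y : sSet) (u v : smap X Y) :
  (forall n (x : X n), u n x = v n x) -> u = v.
Proof.
case: u v => [u uP] [v vP] /= uv.
have e : u = v by apply: functional_extensionality_dep => n; apply: funext => x.
by rewrite e in uP *; congr SMap; apply: Prop_irrelevance.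
Qed.

Definition scomp (X Y Z : sSet) (v : smap Y Z) (u : smap X Y) : smap X Z.
Proof.
refine (SMap (fun n x => v n (u n x)) _).
by move=> m n f x; rewrite !sfun_act.
Defined.

Definition sid (X : sSet) : smap X X :=
  SMap (fun n x => x) (fun _ _ _ _ => erefl).

Definition vertex (X : sSet) n (x : X n) (i : 'I_n.+1) : X 0 :=
  act (mconst 0 i) x.

Record subset (X : sSet) := Subset {
  mem_sub :> forall n, X n -> Prop;
  mem_act : forall m n (f : mono m n) (x : X n),
    mem_sub x -> mem_sub (act f x) }.
Arguments Subset {X}.
Arguments mem_sub {X} _ {n}.

Lemma sig_eq T (P : T -> Prop) (x y : {t | P t}) : sval x = sval y -> x = y.
Proof.
by case: x y => [x px] [y py] /= e; subst y; congr exist; apply: Prop_irrelevance.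
Qed.

Definition sub (X : sSet) (A : subset X) : sSet.
Proof.
refine (@SSet (fun n => {x : X n | A n x})
  (fun m n f x => exist _ (act f (sval x)) (mem_act f (svalP x))) _ _).
- by move=> n x; apply: sig_eq; rewrite /= act_id.
- by move=> m n p f g x; apply: sig_eq; rewrite /= act_comp.
Defined.

Definition sub_incl (X : sSet) (A : subset X) : smap (sub A) X :=
  @SMap (sub A) X (fun n x => sval x) (fun _ _ _ _ => erefl).

Definition sub_corestr (X Y : sSet) (B : subset Y) (u : smap X Y)
  (uB : forall n (x : X n), B n (u n x)) : smap X (sub B).
Proof.
refine (@SMap X (sub B) (fun n x => exist _ (u n x) (uB n x)) _).
by move=> m n f x; apply: sig_eq; rewrite /= sfun_act.
Defined.

Definition image (X Y : sSet) (u : smap X Y) : subset Y.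
Proof.
refine (Subset (fun n y => exists x : X n, u n x = y) _).
by move=> m n f y [x <-]; exists (act f x); rewrite sfun_act.
Defined.

Definition union (X : sSet) (A B : subset X) : subset X.
Proof.
refine (Subset (fun n x => A n x \/ B n x) _).
by move=> m n f x [?|?]; [left|right]; apply: mem_act.
Defined.

Lemma vertex_act (X : sSet) m n (f : mono m n) (x : X n) i :
  vertex (act f x) i = vertex x (f i).
Proof. by rewrite /vertex -act_comp mcomp_constr. Qed.

Lemma vertex_sfun (X Y : sSet) (u : smap X Y) n (x : X n) i :
  vertex (u n x) i = u 0 (vertex x i).
Proof. by rewrite /vertex sfun_act. Qed.

(* The 0-full simplicial subset on the vertices satisfying [P]. *)
Definition zero_full (X : sSet) (P : X 0 -> Prop) : subset X.
Proof.
refine (Subset (fun n x => forall i, P (vertex x i)) _).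
by move=> m n f x xP i; rewrite vertex_act.
Defined.

Definition Delta (n : nat) : sSet.
Proof.
refine (@SSet (fun k => mono k n) (fun m k f x => mcomp x f) _ _).
- by move=> k x; apply: mcomp1.
- by move=> m k p f g x; rewrite mcompA.
Defined.

Definition Delta_map m n (f : mono m n) : smap (Delta m) (Delta n).
Proof.
refine (@SMap (Delta m) (Delta n) (fun k x => mcomp f x) _).
by move=> k l g x; rewrite /= mcompA.
Defined.

Definition boundary n : subset (Delta n).
Proof.
refine (@Subset (Delta n)
  (fun k f => exists j : 'I_n.+1, forall i, f i <> j) _).
by move=> m k g f [j fj]; exists j => i; rewrite mcompE.
Defined.

(* The union of the faces of [Delta n] opposite to the vertices j <> k. *)
Definition horn n (k : 'I_n.+1) : subset (Delta n).
Proof.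
refine (@Subset (Delta n)
  (fun l f => exists j : 'I_n.+1, j <> k /\ forall i, f i <> j) _).
by move=> m l g f [j [jk fj]]; exists j; split=> // i; rewrite mcompE.
Defined.

Definition quasicategory (C : sSet) : Prop :=
  forall n (k : 'I_n.+1), 0 < k -> k < n ->
  forall h : smap (sub (horn k)) C,
  exists s : smap (Delta n) C, scomp s (sub_incl (horn k)) = h.

Definition sprod (X Y : sSet) : sSet.
Proof.
refine (@SSet (fun n => (X n * Y n)%type)
  (fun m n f x => (act f x.1, act f x.2)) _ _).
- by move=> n [x y]; rewrite /= !act_id.
- by move=> m n p f g [x y]; rewrite /= !act_comp.
Defined.

Definition sprod_map (X X' Y Y' : sSet) (u : smap X X') (v : smap Y Y') :
  smap (sprod X Y) (sprod X' Y').
Proof.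
refine (@SMap (sprod X Y) (sprod X' Y') (fun n x => (u n x.1, v n x.2)) _).
by move=> m n f x; rewrite /= !sfun_act.
Defined.

Definition sfst (X Y : sSet) : smap (sprod X Y) X :=
  @SMap (sprod X Y) X (fun n x => x.1) (fun _ _ _ _ => erefl).

Definition ssnd (X Y : sSet) : smap (sprod X Y) Y :=
  @SMap (sprod X Y) Y (fun n x => x.2) (fun _ _ _ _ => erefl).

(* [exp K C] is C^K: its n-simplices are the maps K x Delta[n] -> C. *)
Definition exp (K C : sSet) : sSet.
Proof.
refine (@SSet (fun n => smap (sprod K (Delta n)) C)
  (fun m n f x => scomp x (sprod_map (sid K) (Delta_map f))) _ _).
- move=> n x; apply: smap_eq => k [a b] /=; congr (x k (a, _)).
  by apply: mono_eq => i; rewrite mcompE midE.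
- by move=> m n p f g x; apply: smap_eq => k [a b] /=; rewrite mcompA.
Defined.

Definition exp_pre (K L C : sSet) (u : smap K L) : smap (exp L C) (exp K C).
Proof.
refine (@SMap (exp L C) (exp K C)
  (fun n x => scomp x (sprod_map u (sid (Delta n)))) _).
by move=> m n f x; apply: smap_eq.
Defined.

(* The map K -> C corresponding to a vertex of C^K, under K x Delta[0] = K. *)
Definition diagram (K C : sSet) (x : exp K C 0) : smap K C.
Proof.
refine (@SMap K C (fun n a => x n (a, mconst n ord0)) _).
by move=> m n f a; rewrite -sfun_act /= mcomp_const.
Defined.

Definition fiber n (c : mono n 1) (e : 'I_2) : subset (Delta n).
Proof.
refine (@Subset (Delta n) (fun k f => mcomp c f = mconst k e) _).
by move=> m k g f fE; rewrite /= -mcompA fE mcomp_const.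
Defined.

Definition fiber_map m n (c : mono n 1) (f : mono m n) (e : 'I_2) :
  smap (sub (fiber (mcomp c f) e)) (sub (fiber c e)).
Proof.
refine (@sub_corestr _ _ (fiber c e) (scomp (Delta_map f) (sub_incl _)) _).
by move=> k [g gE] /=; rewrite -mcompA.
Defined.

(* An n-simplex of the join K * L is a cut of [n] into an initial segment
   [cut = 0] and a final segment [cut = 1], either of which may be empty,
   together with a simplex of K on the former and a simplex of L on the latter;
   a simplex on a segment S is encoded as a map from the full simplicial subset
   of Delta[n] on S, so that no datum is carried when S is empty. *)
Record join_simplex (K L : sSet) n := JoinSimplex {
  cut : mono n 1;
  front : smap (sub (fiber cut ord0)) K;
  back : smap (sub (fiber cut ord_max)) L }.

Lemma join_eq (K L : sSet) n (x y : join_simplex K L n) :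
  cut x = cut y ->
  (forall k f hx hy, front x k (exist _ f hx) = front y k (exist _ f hy)) ->
  (forall k f hx hy, back x k (exist _ f hx) = back y k (exist _ f hy)) ->
  x = y.
Proof.
case: x y => [c u v] [c' u' v'] /= e; subst c' => eu ev.
by congr JoinSimplex; apply: smap_eq => k [f h].
Qed.

Definition join (K L : sSet) : sSet.
Proof.
refine (@SSet (join_simplex K L) (fun m n f x =>
  @JoinSimplex K L m (mcomp (cut x) f)
    (scomp (front x) (fiber_map (cut x) f ord0))
    (scomp (back x) (fiber_map (cut x) f ord_max))) _ _).
- move=> n x; apply: join_eq => [|k f hx hy|k f hx hy] /=; first exact: mcomp1.
  + congr (front x k _); apply: sig_eq => /=.
    by apply: mono_eq => i; rewrite mcompE midE.
  + congr (back x k _); apply: sig_eq => /=.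
    by apply: mono_eq => i; rewrite mcompE midE.
- move=> m n p f g x; apply: join_eq => [|k h hx hy|k h hx hy] /=.
  + by rewrite mcompA.
  + by congr (front x k _); apply: sig_eq; rewrite /= mcompA.
  + by congr (back x k _); apply: sig_eq; rewrite /= mcompA.
Defined.

Lemma const_fiberF n k (f : mono k n) (e e' : 'I_2) :
  e != e' -> mcomp (mconst n e) f = mconst k e' -> False.
Proof.
move=> ee' fE; have := congr1 (fun g : mono k 1 => g ord0) fE.
by rewrite mcompE !mconstE => /eqP; rewrite (negPf ee').
Qed.

Lemma ord0max : (ord0 : 'I_2) != ord_max. Proof. by []. Qed.

Definition join_inl_simplex (K L : sSet) n (x : K n) : join K L n.
Proof.
refine (@JoinSimplex K L n (mconst n ord0) _ _).
- refine (@SMap (sub (fiber (mconst n ord0) ord0)) K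
    (fun k f => act (sval f) x) _).
  by move=> m k g f; rewrite /= act_comp.
- refine (@SMap (sub (fiber (mconst n ord0) ord_max)) L
    (fun k f => False_rect _ (const_fiberF ord0max (svalP f))) _).
  by move=> m k g f; case: (const_fiberF ord0max (svalP f)).
Defined.

Definition join_inl (K L : sSet) : smap K (join K L).
Proof.
refine (@SMap K (join K L) (@join_inl_simplex K L) _).
move=> m n f x; apply: join_eq => [|k g hx hy|k g hx hy] /=.
- by rewrite mcomp_const.
- by rewrite act_comp.
- by case: (const_fiberF ord0max hx).
Defined.

Definition join_mapr (K L L' : sSet) (u : smap L L') :
  smap (join K L) (join K L').
Proof.
refine (@SMap (join K L) (join K L')
  (fun n x => @JoinSimplex K L' n (cut x) (front x) (scomp u (back x))) _).
move=> m n f x; apply: join_eq => [|k g hx hy|k g hx hy] //=.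
- by congr (front x k _); apply: sig_eq.
- by congr (u k (back x k _)); apply: sig_eq.
Defined.

Lemma join_mapr_inl (K L L' : sSet) (u : smap L L') :
  scomp (join_mapr K u) (join_inl K L) = join_inl K L'.
Proof.
apply: smap_eq => n x; apply: join_eq => [|k g hx hy|k g hx hy] //=.
by case: (const_fiberF ord0max hx).
Qed.

Lemma scompA (W X Y Z : sSet) (w : smap Y Z) (v : smap X Y) (u : smap W X) :
  scomp (scomp w v) u = scomp w (scomp v u).
Proof. exact: smap_eq. Qed.

(* The slice C_(p/) of C under p : K -> C; its n-simplices are the maps
   K * Delta[n] -> C extending p. *)
Definition slice_simplex (K C : sSet) (p : smap K C) n :=
  {q : smap (join K (Delta n)) C | scomp q (join_inl K (Delta n)) = p}.

Definition slice_act (K C : sSet) (p : smap K C) m n (f : mono m n)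
  (q : slice_simplex p n) : slice_simplex p m.
Proof.
exists (scomp (sval q) (join_mapr K (Delta_map f))).
by rewrite scompA join_mapr_inl (svalP q).
Defined.

Definition slice (K C : sSet) (p : smap K C) : sSet.
Proof.
refine (@SSet (slice_simplex p) (@slice_act K C p) _ _).
- move=> n [q qp]; apply: sig_eq; apply: smap_eq => k x /=; congr (q k _).
  apply: join_eq => [|l g hx hy|l g hx hy] //=.
    by congr (front x l _); apply: sig_eq.
  have -> : exist _ g hx = exist _ g hy :> sub (fiber (cut x) ord_max) l.
    exact: sig_eq.
  by apply: mono_eq => i; rewrite mcompE midE.
- move=> m n r f g [q qp]; apply: sig_eq; apply: smap_eq => k x /=.
  congr (q k _); apply: join_eq => [|l h hx hy|l h hx hy] //=.
  + by congr (front x l _); apply: sig_eq.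
  + rewrite mcompA; congr (mcomp g (mcomp f (back x l _))).
    exact: sig_eq.
Defined.

Lemma boundary_vertex n (i : 'I_n.+2) : boundary n.+1 0 (mconst 0 i).
Proof.
case: (altP (i =P ord0)) => [->|/eqP i0]; [exists ord_max|exists ord0] => k;
  by rewrite mconstE.
Qed.

(* Joyal: every simplicial sphere of dimension n > 0 in X whose 0-th vertex
   is i can be filled. *)
Definition initial (X : sSet) (i : X 0) : Prop :=
  forall n (b : smap (sub (boundary n.+1)) X),
    b 0 (exist _ (mconst 0 ord0) (boundary_vertex ord0)) = i ->
  exists s : smap (Delta n.+1) X, scomp s (sub_incl (boundary n.+1)) = b.

(* A vertex of C_(p/), that is, a cocone under p, is a colimit of p. *)
Definition is_colimit (K C : sSet) (p : smap K C) (q : slice p 0) : Prop :=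
  initial q.

(* The first coordinate is horizontal and the second one vertical: the objects
   C1, C2, C3, C4 of a square sit at (0,0), (1,0), (0,1), (1,1). *)
Definition sqJ : sSet := sprod (Delta 1) (Delta 1).

(* The nerve of the subcategory {(0,1) <- (0,0) -> (1,0)} of [1] x [1], which is
   full on its objects, consists of the simplices that miss (1,1). *)
Definition spanI_subset : subset sqJ.
Proof.
refine (@Subset sqJ
  (fun n x => forall i, ~ (x.1 i = ord_max /\ x.2 i = ord_max)) _).
by move=> m n f [a b] /= ab i; rewrite !mcompE.
Defined.

Definition spanI : sSet := sub spanI_subset.

Definition inclI : smap spanI sqJ := sub_incl spanI_subset.

Definition top_edge_sqJ : smap (Delta 1) sqJ.
Proof.
refine (@SMap (Delta 1) sqJ (fun n a => (a, mconst n ord0)) _).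
by move=> m n f a; rewrite /= mcomp_const.
Defined.

Lemma top_edge_subproof n (a : Delta 1 n) :
  spanI_subset n (top_edge_sqJ n a).
Proof. by move=> i [_]; rewrite mconstE. Qed.

Definition top_edge : smap (Delta 1) spanI :=
  sub_corestr top_edge_subproof.

Definition left_edge_sqJ : smap (Delta 1) sqJ.
Proof.
refine (@SMap (Delta 1) sqJ (fun n a => (mconst n ord0, a)) _).
by move=> m n f a; rewrite /= mcomp_const.
Defined.

Lemma left_edge_subproof n (a : Delta 1 n) :
  spanI_subset n (left_edge_sqJ n a).
Proof. by move=> i []; rewrite mconstE. Qed.

Definition left_edge : smap (Delta 1) spanI :=
  sub_corestr left_edge_subproof.

Definition projh : smap sqJ (Delta 1) := sfst (Delta 1) (Delta 1).
Definition projv : smap sqJ (Delta 1) := ssnd (Delta 1) (Delta 1).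

(* The canonical map I * Delta[0] -> J, which is the inclusion on I and sends
   the cone point to (1,1); it is an isomorphism (lemma [cone_to_sqJ_bij]).
   On a simplex it is computed vertex by vertex. *)
Definition front_vertex n (x : join spanI (Delta 0) n) (i : 'I_n.+1) :
    option (spanI 0) :=
  match cut x i =P ord0 with
  | ReflectT e => Some (front x 0 (exist _ (mconst 0 i)
      (etrans (mcomp_constr 0 i (cut x)) (congr1 (@mconst 0 1) e))))
  | ReflectF _ => None
  end.

Definition cone_coord (pr : smap sqJ (Delta 1)) n
    (x : join spanI (Delta 0) n) (i : 'I_n.+1) : 'I_2 :=
  if front_vertex x i is Some v then (pr 0 (inclI 0 v) : mono 0 1) ord0
  else ord_max.

Lemma cone_coord_front pr n (x : join spanI (Delta 0) n) k (f : mono k n) h i :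
  cone_coord pr x (f i) =
  (pr k (inclI k (front x k (exist _ f h))) : mono k 1) i.
Proof.
rewrite /cone_coord /front_vertex; case: eqP => [e|]; last first.
  by case; rewrite -mcompE h mconstE.
set w := exist _ _ _.
have -> : w = act (mconst 0 i) (exist _ f h : sub (fiber (cut x) ord0) k).
  by apply: sig_eq; rewrite /= mcomp_constr.
by rewrite !sfun_act [LHS]mcompE mconstE.
Qed.

Lemma cone_coord_back pr n (x : join spanI (Delta 0) n) i :
  cut x i <> ord0 -> cone_coord pr x i = ord_max.
Proof. by rewrite /cone_coord /front_vertex; case: eqP. Qed.

Lemma ord2P (i : 'I_2) : i = ord0 \/ i = ord_max.
Proof.
by case: i => [[|[|//]] h]; [left|right]; apply: val_inj.
Qed.

Lemma cone_coord_mono pr n (x : join spanI (Delta 0) n) (i j : 'I_n.+1) :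
  i <= j -> cone_coord pr x i <= cone_coord pr x j.
Proof.
move=> ij; case: (cut x j =P ord0) => [xj|/cone_coord_back ->]; last first.
  exact: leq_ord.
have fP (a b : 'I_2) : a <= b ->
    (if a == ord0 then i else j) <= (if b == ord0 then i else j).
  by case: (ord2P a) (ord2P b) => -> [] ->.
pose f : mono 1 n := mkmono fP.
have h : fiber (cut x) ord0 1 f.
  apply: mono_eq => a; rewrite mcompE mkmonoE mconstE; case: ifP => // _.
  by apply/val_inj/eqP; rewrite /= -leqn0; have := mono_le (cut x) ij; rewrite xj.
have := mono_le (pr 1 (inclI 1 (front x 1 (exist _ f h))) : mono 1 1)
  (leq0n (ord_max : 'I_2) : (ord0 : 'I_2) <= (ord_max : 'I_2)).
by rewrite -!cone_coord_front !mkmonoE.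
Qed.

Lemma cone_coord_act pr m n (f : mono m n) (x : join spanI (Delta 0) n) i :
  cone_coord pr (act f x) i = cone_coord pr x (f i).
Proof.
case: (cut x (f i) =P ord0) => [e|ne]; last first.
  by rewrite !cone_coord_back //= mcompE.
have h : fiber (cut (act f x)) ord0 0 (mconst 0 i).
  by rewrite /= mcomp_constr mcompE e.
rewrite -[i in LHS](mconstE i (ord0 : 'I_1)) (cone_coord_front pr h) /=.
rewrite -(cone_coord_front pr) mcompE.
by rewrite mconstE.
Qed.

Definition cone_to_sqJ : smap (join spanI (Delta 0)) sqJ.
Proof.
refine (@SMap (join spanI (Delta 0)) sqJ (fun n x =>
  (mkmono (cone_coord_mono projh x), mkmono (cone_coord_mono projv x))) _).
by move=> m n f x; congr pair; apply: mono_eq => i;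
   rewrite mcompE !mkmonoE cone_coord_act.
Defined.

Lemma cone_to_sqJ_inl : scomp cone_to_sqJ (join_inl spanI (Delta 0)) = inclI.
Proof.
have cE pr n (x : spanI n) i :
    cone_coord pr (join_inl spanI (Delta 0) n x) i =
    (pr n (inclI n x) : mono n 1) i.
  have h : fiber (cut (join_inl spanI (Delta 0) n x)) ord0 n (mid n).
    exact: mcomp1.
  rewrite -[i in LHS]midE (cone_coord_front pr h) -[x in RHS]act_id.
  by [].
apply: smap_eq => n x.
rewrite [RHS]surjective_pairing; congr pair;
  by apply: mono_eq => i; rewrite mkmonoE cE.
Qed.

Lemma sqJ_cut_mono n (y : sqJ n) (i j : 'I_n.+1) : i <= j ->
  (if y.1 i == ord0 then ord0 else y.2 i : 'I_2) <=
  (if y.1 j == ord0 then ord0 else y.2 j : 'I_2).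
Proof.
move=> ij; have := mono_le y.1 ij; have := mono_le y.2 ij.
by case: (ord2P (y.1 i)) (ord2P (y.1 j)) => -> [] ->.
Qed.

Definition sqJ_cut n (y : sqJ n) : mono n 1 := mkmono (sqJ_cut_mono y).

Lemma sqJ_front_subproof n (y : sqJ n) k (f : sub (fiber (sqJ_cut y) ord0) k) :
  spanI_subset k (act (sval f) y).
Proof.
case: f => f fc i /=; rewrite !mcompE => -[y1 y2].
have := congr1 (fun g : mono k 1 => g i) fc.
by rewrite mcompE mkmonoE mconstE y1 y2.
Qed.

Definition sqJ_to_cone n (y : sqJ n) : join spanI (Delta 0) n.
Proof.
refine (@JoinSimplex _ _ n (sqJ_cut y) _ _).
- refine (@SMap (sub (fiber (sqJ_cut y) ord0)) spanI
    (fun k f => exist _ (act (sval f) y) (@sqJ_front_subproof n y k f)) _).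
  by move=> j k g f; apply: sig_eq; rewrite /= !mcompA.
- refine (@SMap (sub (fiber (sqJ_cut y) ord_max)) (Delta 0)
    (fun k _ => mconst k ord0) _).
  by move=> j k g f; rewrite /= mcomp_const.
Defined.

Lemma cut_sqJ_to_cone n (y : sqJ n) i :
  cut (sqJ_to_cone y) i = if y.1 i == ord0 then ord0 else y.2 i.
Proof. exact: mkmonoE. Qed.

Lemma cone_to_sqJ1 n (x : join spanI (Delta 0) n) i :
  (cone_to_sqJ n x).1 i = cone_coord projh x i.
Proof. exact: mkmonoE. Qed.

Lemma cone_to_sqJ2 n (x : join spanI (Delta 0) n) i :
  (cone_to_sqJ n x).2 i = cone_coord projv x i.
Proof. exact: mkmonoE. Qed.

Lemma cone_to_sqJ_bij n : bijective (cone_to_sqJ n).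
Proof.
exists (@sqJ_to_cone n).
- move=> x; apply: join_eq => [|k f hx hy|k f hx hy].
  + apply: mono_eq => i; rewrite cut_sqJ_to_cone cone_to_sqJ1 cone_to_sqJ2.
    case: (cut x i =P ord0) => [e|ne]; last first.
      by rewrite !cone_coord_back //=; case: (ord2P (cut x i)) => [/ne|->].
    have h : fiber (cut x) ord0 0 (mconst 0 i) by rewrite /= mcomp_constr e.
    rewrite -[i](mconstE i (ord0 : 'I_1)) !(cone_coord_front _ h) mconstE e.
    case: (front x 0 _) => -[a b] /= /(_ ord0) /=.
    by case: (ord2P (a ord0)) (ord2P (b ord0)) => -> [] -> // [].
  + apply: sig_eq => /=; rewrite [RHS]surjective_pairing.
    congr pair; apply: mono_eq => i; rewrite mcompE mkmonoE.
      exact: (cone_coord_front projh hy).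
    exact: (cone_coord_front projv hy).
  + by rewrite [LHS]mono0E [RHS]mono0E.
- have E (pr : smap sqJ (Delta 1)) (y : sqJ n) i :
      (y.1 i = ord_max -> y.2 i = ord_max ->
        (pr n y : mono n 1) i = ord_max) ->
    cone_coord pr (sqJ_to_cone y) i = (pr n y : mono n 1) i.
    move=> prP; case: (cut (sqJ_to_cone y) i =P ord0) => [e|ne].
      have h : fiber (cut (sqJ_to_cone y)) ord0 0 (mconst 0 i).
        by rewrite /= mcomp_constr e.
      rewrite -[i in LHS](mconstE i (ord0 : 'I_1)) (cone_coord_front pr h).
      by rewrite sfun_act [LHS]mcompE mconstE.
    rewrite cone_coord_back //; move: ne; rewrite cut_sqJ_to_cone.
    by case: (ord2P (y.1 i)) (ord2P (y.2 i)) => e1 [] e2;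
      rewrite e1 ?e2 ?eqxx //= prP.
  by move=> y; rewrite [RHS]surjective_pairing; congr pair;
    apply: mono_eq => i; rewrite mkmonoE E.
Qed.

Definition square_cocone (C : sSet) (s : smap sqJ C) : slice (scomp s inclI) 0.
Proof.
exists (scomp s cone_to_sqJ).
by rewrite scompA cone_to_sqJ_inl.
Defined.

Definition is_pushout (C : sSet) (s : smap sqJ C) : Prop :=
  is_colimit (square_cocone s).

Section Cofibrations.

(* [cof] is the distinguished class of morphisms (1-simplices). *)
Variables (C : sSet) (cof : C 1 -> Prop).

Definition identity (x : C 0) : C 1 := act (mconst 1 ord0) x.

Definition identities_cof : Prop := forall x : C 0, cof (identity x).

Definition arrow (x : smap (Delta 1) C) : C 1 := x 1 (mid 1).

Definition left_map (d : smap spanI C) : C 1 := arrow (scomp d left_edge).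

Definition pushouts_along_cof : Prop :=
  forall d : smap spanI C, cof (left_map d) ->
  exists s : smap sqJ C, scomp s inclI = d /\ is_pushout s.

Definition expArr_co_subset : subset (exp (Delta 1) C) :=
  zero_full (fun x => cof (arrow (diagram x))).
Definition expArr_co : sSet := sub expArr_co_subset.

Definition expI_co_subset : subset (exp spanI C) :=
  zero_full (fun x => cof (left_map (diagram x))).
Definition expI_co : sSet := sub expI_co_subset.

Definition expJ_co_subset : subset (exp sqJ C) :=
  zero_full (fun x => cof (left_map (scomp (diagram x) inclI))).
Definition expJ_co : sSet := sub expJ_co_subset.

Definition expJ_co_po_subset : subset expJ_co :=
  zero_full (fun x : expJ_co 0 => is_pushout (diagram (sval x))).
Definition expJ_co_po : sSet := sub expJ_co_po_subset.

Definition expJ_co_po_incl : smap expJ_co_po (exp sqJ C) :=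
  scomp (sub_incl expJ_co_subset) (sub_incl expJ_co_po_subset).

Lemma res_po_subproof n (x : expJ_co_po n) :
  expI_co_subset n (exp_pre C inclI n (expJ_co_po_incl n x)).
Proof.
case: x => [[x xco] xpo] i; rewrite vertex_sfun.
exact: (xco i).
Qed.

Definition res_po : smap expJ_co_po expI_co :=
  @sub_corestr _ _ expI_co_subset (scomp (exp_pre C inclI) expJ_co_po_incl)
    res_po_subproof.

Hypothesis idco : identities_cof.

Lemma left_id_subproof n (f : exp (Delta 1) C n) :
  expI_co_subset n (exp_pre C (scomp projh inclI) n f).
Proof.
move=> i; rewrite vertex_sfun; set v := vertex f i.
have -> : left_map (diagram (exp_pre C (scomp projh inclI) 0 v)) =
          identity (diagram v 0 (mconst 0 ord0)); last exact: idco.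
rewrite /identity -sfun_act /left_map /arrow /=.
by rewrite (mcomp_const ord0 (mconst 1 ord0)).
Qed.

(* f |-> (<-Id- -f->) *)
Definition left_id : smap (exp (Delta 1) C) expI_co :=
  @sub_corestr _ _ expI_co_subset (exp_pre C (scomp projh inclI))
    left_id_subproof.

Lemma top_id_subproof n (g : expArr_co n) :
  expI_co_subset n (exp_pre C (scomp projv inclI) n (sval g)).
Proof.
by case: g => [g gco] i; rewrite vertex_sfun; apply: (gco i).
Qed.

(* g |-> (<-g- -Id->) *)
Definition top_id : smap expArr_co expI_co :=
  @sub_corestr _ _ expI_co_subset
    (scomp (exp_pre C (scomp projv inclI)) (sub_incl expArr_co_subset))
    top_id_subproof.

Definition expI_Id_subset : subset expI_co :=
  union (image left_id) (image top_id).
Definition expI_Id : sSet := sub expI_Id_subset.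

(* f and g are recovered from the diagram by restricting it to the top and left
   edges; a simplex in both images has f and g degenerate at the same object,
   and the two extensions then agree (lemma [id_ext_agree]). *)
Definition id_ext_simplex n (x : exp spanI C n) (b : bool) : exp sqJ C n :=
  if b then exp_pre C projh n (exp_pre C top_edge n x)
  else exp_pre C projv n (exp_pre C left_edge n x).

Definition in_left_id n (x : expI_co n) : bool := `[< image left_id n x >].

Definition id_ext_fun n (x : expI_Id n) : exp sqJ C n :=
  id_ext_simplex (sval (sval x)) (in_left_id (sval x)).

Lemma id_ext_simplex_left n (f : exp (Delta 1) C n) :
  id_ext_simplex (sval (left_id n f)) true = exp_pre C projh n f.
Proof. by apply: smap_eq => k [[a b] c]. Qed.

Lemma id_ext_simplex_top n (g : expArr_co n) :
  id_ext_simplex (sval (top_id n g)) false = exp_pre C projv n (sval g).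
Proof. by apply: smap_eq => k [[a b] c]. Qed.

Lemma id_ext_agree n (x : expI_co n) : image left_id n x -> image top_id n x ->
  id_ext_simplex (sval x) true = id_ext_simplex (sval x) false.
Proof.
move=> [f fx] [g gx]; have fg := congr1 sval (etrans fx (esym gx)).
rewrite -{1}fx -gx id_ext_simplex_left id_ext_simplex_top.
have E k (a b : mono k 1) (c : mono k n) (h : spanI_subset k (a, b)) :
    f k (a, c) = sval g k (b, c) :> C k.
  exact: (congr1 (fun y : exp spanI C n => y k (exist _ (a, b) h, c)) fg).
apply: smap_eq => k [[a b] c] /=.
have h1 : spanI_subset k (a, mconst k ord0) by move=> i [_]; rewrite /= mconstE.
have h2 : spanI_subset k (mconst k ord0, mconst k ord0).
  by move=> i [_]; rewrite /= mconstE.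
have h3 : spanI_subset k (mconst k ord0, b) by move=> i []; rewrite /= mconstE.
by rewrite (E _ _ _ _ h1) -(E _ _ _ _ h2) (E _ _ _ _ h3).
Qed.

Lemma id_ext_left n (x : expI_Id n) : image left_id n (sval x) ->
  id_ext_fun x = id_ext_simplex (sval (sval x)) true.
Proof. by move=> xl; rewrite /id_ext_fun /in_left_id (asboolT xl). Qed.

Lemma id_ext_top n (x : expI_Id n) : image top_id n (sval x) ->
  id_ext_fun x = id_ext_simplex (sval (sval x)) false.
Proof.
move=> xt; rewrite /id_ext_fun; case E: (in_left_id _) => //.
by apply: id_ext_agree => //; apply/asboolP.
Qed.

Lemma id_ext_act m n (f : mono m n) (x : expI_Id n) :
  id_ext_fun (act f x) = act f (id_ext_fun x).
Proof.
have act_simplex b (y : exp spanI C n) :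
    id_ext_simplex (act f y) b = act f (id_ext_simplex y b).
  by case: b; rewrite /id_ext_simplex !sfun_act.
case: (svalP x) => xi.
- by rewrite (id_ext_left xi) id_ext_left ?act_simplex //; apply: mem_act.
- by rewrite (id_ext_top xi) id_ext_top ?act_simplex //; apply: mem_act.
Qed.

Definition id_ext : smap expI_Id (exp sqJ C) := SMap id_ext_fun id_ext_act.

Lemma id_ext_left_id n (f : exp (Delta 1) C n) h :
  id_ext n (exist _ (left_id n f) h) = exp_pre C projh n f.
Proof.
by rewrite [LHS]id_ext_left ?id_ext_simplex_left //; exists f.
Qed.

Lemma id_ext_top_id n (g : expArr_co n) h :
  id_ext n (exist _ (top_id n g) h) = exp_pre C projv n (sval g).
Proof.
by rewrite [LHS]id_ext_top ?id_ext_simplex_top //; exists g.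
Qed.

End Cofibrations.

(* Main.v *)
From mathcomp Require Import all_boot zify.
From mathcomp Require Import boolp classical_sets.
Require Import Defs.

Set Implicit Arguments.
Unset Strict Implicit.
Unset Printing Implicit Defensive.

(** The map [res_po] lifts against every boundary inclusion, and such a map has
    sections extending any section prescribed on a simplicial subset
    ([section_extension]). Here the prescribed section is [id_ext], so there are
    two things to prove: that the identity squares are pushouts, so that [id_ext]
    takes values in the source of [res_po], and that [res_po] lifts against the
    boundary inclusions.

    Both are problems of extending a map with values in [C] over a few more chains
    of a finite poset. Such an extension is obtained by attaching simplices along
    horns, and for a large family of chains by a matching: each new chain is paired
    with the one obtained by adding or removing a pivot vertex, and the pairs are
    attached in an order in which all the other faces of a chain come before it
    ([extend_matching]).

    Lifting in dimension 0 is the existence of pushouts. In positive dimension the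
    datum is a map on the union of [I x Delta n] and [J x boundary n], to be
    extended to [J x Delta n]. A matching by inner horns reaches all chains except
    those that contain every vertex of the copy of [Delta n] at the corner (1,1)
    of the square ([extend_prism]). The remaining chains, together with their
    faces, form the join of [I x {0}] with [Delta n], and the map to be extended
    is given on the join with the boundary of [Delta n]: this is a sphere in a
    slice of [C] whose vertex 0 is a pushout square, hence an initial object, so it
    can be filled ([pushout_extends]).

    Conversely, a square is a pushout as soon as all extension problems of the
    latter kind are solvable ([extends_pushout]). For an identity square three
    horns suffice, one of them inner and the other two outer with a degenerate
    first edge. Outer horns of that kind have fillers in any quasicategory
    ([SpecialHorn.special_horn_fills]); this special case of Joyal's theorem on
    horns whose first edge is invertible is derived from inner horns alone. *)

(** * Extending a section along a simplicial subset *)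

Definition onto k n (f : mono k n) : Prop := forall j, exists i, f i = j.

Lemma not_ontoP k n (f : mono k n) : ~ onto f -> boundary n k f.
Proof.
move=> /existsNP[j fj]; exists j => i fi; apply: fj; by exists i.
Qed.

Lemma onto_endo n (f : mono n n) : onto f -> f = mid n.
Proof.
move=> fo; have fi : injective f.
  apply/injectiveP/card_uniqP; rewrite size_map -cardE.
  apply: eq_card => j; have [i <-] := fo j.
  by rewrite map_f ?mem_enum.
have fs (i j : 'I_n.+1) : i < j -> f i < f j.
  move=> ij; rewrite ltn_neqAle mono_le 1?ltnW // andbT.
  by apply: contraTneq ij => /val_inj/fi->; rewrite ltnn.
have ge m (i : 'I_n.+1) : val i = m -> i <= f i.
  elim: m i => [|m IH] i im; first by rewrite im.
  have mn : m < n.+1 by rewrite -ltnS -im ltnS ltnW // ltn_ord.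
  rewrite im; apply: leq_ltn_trans (IH (Ordinal mn) erefl) _.
  by apply: fs; rewrite /= im.
have le m (i : 'I_n.+1) : n - i = m -> f i <= i.
  elim: m i => [|m IH] i im.
    have : n <= i by rewrite -subn_eq0 im.
    by apply: leq_trans; rewrite -ltnS.
  have ilt : i.+1 < n.+1 by rewrite ltnS -subn_gt0 im.
  have := IH (Ordinal ilt); rewrite /= subnS im => /(_ erefl) h.
  by rewrite -ltnS; apply: leq_trans h; apply: fs; rewrite /=.
apply: mono_eq => i; rewrite midE; apply/val_inj/eqP.
by rewrite eqn_leq (le _ _ erefl) (ge _ _ erefl).
Qed.

(** A surjection is determined by its sections, since a section can be made to
    pass through any prescribed point of the source. *)
Lemma onto_section k n (f : mono k n) (i0 : 'I_k.+1) : onto f ->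
  exists d : mono n k, mcomp f d = mid n /\ d (f i0) = i0.
Proof.
move=> fo; pose d j := if j == f i0 then i0 else odflt ord0 [pick i | f i == j].
have fd j : f (d j) = j.
  rewrite /d; case: eqP => [-> //|_]; case: pickP => [i /eqP // |] /=.
  by have [i fi] := fo j => /(_ i); rewrite fi eqxx.
have dm (i j : 'I_n.+1) : i <= j -> d i <= d j.
  move=> ij; rewrite leqNgt; apply/negP => ji.
  have := mono_le f (ltnW ji); rewrite !fd => ji'.
  have e : i = j by apply/val_inj/eqP; rewrite eqn_leq ij.
  by rewrite e ltnn in ji.
exists (mkmono dm); split; last by rewrite mkmonoE /d eqxx.
by apply: mono_eq => j; rewrite mcompE mkmonoE fd midE.
Qed.

Lemma boundary_factor k n (f : mono k n) : boundary n k f ->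
  exists n' (d : mono n' n) (g : mono k n'), n' < n /\ f = mcomp d g.
Proof.
case: n f => [|n] f [j fj]; first by case: (fj ord0); rewrite !ord1.
have dm (i i' : 'I_n.+1) : i <= i' -> lift j i <= lift j i'.
  by move=> ii; rewrite /= leq_bump2.
pose g i := odflt ord0 (unlift j (f i)).
have gE i : lift j (g i) = f i.
  rewrite /g; case: unliftP => [i' -> //|/esym /eqP].
  by case: eqP => // /esym /fj.
have gm (i i' : 'I_k.+1) : i <= i' -> g i <= g i'.
  by move=> /(mono_le f); rewrite -!gE /= leq_bump2.
exists n, (mkmono dm), (mkmono gm); split=> //.
by apply: mono_eq => i; rewrite mcompE !mkmonoE gE.
Qed.

(** The uniqueness half of the Eilenberg-Zilber lemma. A section [d] of [f] is a
    section of [g] too, for otherwise [x = act (mcomp g d) x] would be a degeneracy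
    of a proper face of [x] and would lie in [A]. *)
Lemma act_onto_inj (X : sSet) (A : forall n, X n -> Prop) n (x : X n) k
    (f g : mono k n) :
  (forall m p (h : mono m p) (z : X p), A p z -> A m (act h z)) ->
  (forall m (h : mono m n), boundary n m h -> A m (act h x)) -> ~ A n x ->
  onto f -> onto g -> act f x = act g x -> f = g.
Proof.
move=> Aact Ab nA fo go e; apply: mono_eq => i.
have [d [fd di]] := onto_section i fo.
have gd : mcomp g d = mid n.
  apply: onto_endo; apply: contrapT => /not_ontoP/Ab.
  by rewrite act_comp -e -act_comp fd act_id.
by rewrite -[in RHS]di -[RHS]mcompE gd midE.
Qed.

Section SectionExtension.
Variables (X Y : sSet) (p : smap Y X) (A : Defs.subset X) (a : smap (sub A) Y).
Hypothesis pa : scomp p a = sub_incl A.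
Hypothesis fill : forall n (x : X n) (b : smap (sub (boundary n)) Y),
  (forall k (d : sub (boundary n) k), p k (b k d) = act (sval d) x) ->
  exists y : Y n, p n y = x /\
    forall k (d : sub (boundary n) k), act (sval d) y = b k d.

(* Partial sections are encoded by their graphs. *)
Let cell := {n & (X n * Y n)%type}.
Let pt n x y : cell := existT _ n (x, y).
Let over_A : set cell :=
  [set c | exists h : A (projT1 c) (projT2 c).1,
     (projT2 c).2 = a (projT1 c) (exist _ _ h)].
Let good (G : set cell) : Prop :=
  [/\ forall n x y y', G (@pt n x y) -> G (@pt n x y') -> y = y',
      forall n x y, G (@pt n x y) -> p n y = x &
      forall m n (f : mono m n) x y, G (pt x y) -> G (pt (act f x) (act f y))].

Let good_chain (F : set (set cell)) :
  (F `<=` [set G | good (G `|` over_A)])%classic ->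
  total_on F (fun G H => (G `<=` H)%classic) ->
  good ((\bigcup_(G in F) G) `|` over_A).
Proof.
move=> Fgood Ftot.
have A_good : good over_A.
  split=> [n x y y' [h /= ->] [h' /= ->]|n x y [h /= ->]|m n f x y [h /= ->]].
  - by congr (a n _); apply: sig_eq.
  - exact: (congr1 (fun u : smap (sub A) X => u n (exist _ x h)) pa).
  - exists (mem_act f h) => /=; rewrite -sfun_act; congr (a m _); exact: sig_eq.
(* Two pairs in the union lie in a single member of the chain. *)
have common c c' : ((\bigcup_(G in F) G) `|` over_A)%classic c ->
    ((\bigcup_(G in F) G) `|` over_A)%classic c' ->
    exists G : set cell, [/\ good G, G c, G c' &
      (G `<=` (\bigcup_(G in F) G) `|` over_A)%classic].
  have inF G : F G -> (G `|` over_A `<=` (\bigcup_(G in F) G) `|` over_A)%classic.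
    by move=> FG z [Gz|Az]; [left; exists G|right].
  move=> [[G FG Gc]|Ac] [[H FH Hc]|Ac'].
  - case: (Ftot _ _ FG FH) => GH;
      [exists (H `|` over_A)%classic|exists (G `|` over_A)%classic];
      split; try exact: Fgood; try exact: inF; left=> //; exact: GH.
  - by exists (G `|` over_A)%classic; split; [exact: Fgood|left|right|exact: inF].
  - by exists (H `|` over_A)%classic; split; [exact: Fgood|right|left|exact: inF].
  - by exists over_A; split=> // z; right.
split=> [n x y y' xy xy'|n x y xy|m n f x y xy].
- by have [G [[+ _ _] c c' _]] := common _ _ xy xy'; apply; eassumption.
- by have [G [[_ + _] c _ _]] := common _ _ xy xy; apply.
- have [G [[_ _ ga] c _ +]] := common _ _ xy xy; apply; exact: ga.
Qed.

(** Lifting against the boundary inclusions implies lifting against all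
    monomorphisms. By Zorn's lemma there is a maximal partial section; if it
    missed a simplex, then it would miss one, [x], all of whose faces it reaches,
    and a filler [y] over [x] would extend it by the rule that sends a
    degeneracy of [x] to the same degeneracy of [y]. *)
Lemma section_extension :
  exists F : smap X Y, scomp p F = sid X /\ scomp F (sub_incl A) = a.
Proof.
have [G0 [G0good G0max]] := Zorn_bigcup good_chain.
set G := (G0 `|` over_A)%classic in G0good.
have [Gfun Gover Gact] : good G by [].
have Gmax B : (G `<=` B)%classic -> good B -> (B `<=` G)%classic.
  move=> GB Bgood; apply: contrapT => BG; case: (G0max B).
    split; first by move=> z Gz; apply: GB; left.
    by move=> BG0; apply: BG => z /BG0; left.
  suff e : (B `|` over_A)%classic = B by rewrite /mkset e.
  by apply/seteqP; split=> z; [case=> // Az; apply: GB; right|left].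
pose dom n x := exists y, G (@pt n x y).
have dom_act m n (f : mono m n) x : dom n x -> dom m (act f x).
  by move=> [y /(Gact _ _ f) xy]; exists (act f y).
have total n : forall x, dom n x.
  elim/ltn_ind: n => n IH x; apply: contrapT => ndx.
  have domb k (d : mono k n) : boundary n k d -> dom k (act d x).
    by move=> /boundary_factor[m [e [g [/IH m_lt ->]]]]; rewrite act_comp; apply: dom_act.
  have bP k (d : sub (boundary n) k) : {y | G (pt (act (sval d) x) y)}.
    by apply: cid; apply: domb; apply: svalP.
  have bact m k (f : mono m k) (d : sub (boundary n) k) :
      sval (bP m (act f d)) = act f (sval (bP k d)).
    apply: Gfun (svalP (bP m _)) _.
    by rewrite /= act_comp; apply/Gact/(svalP (bP k d)).
  have [k d|y [py yb]] := @fill n x (SMap (fun k d => sval (bP k d)) bact).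
    exact/Gover/(svalP (bP k d)).
  have Gb k (d : mono k n) : boundary n k d -> G (pt (act d x) (act d y)).
    by move=> dB; rewrite (yb k (exist _ d dB)); apply: svalP (bP k (exist _ d dB)).
  have G_notonto k (f : mono k n) : dom k (act f x) -> ~ onto f.
    move=> fx fo; have [d [fd _]] := onto_section ord0 fo; apply: ndx.
    by rewrite -[x]act_id -fd act_comp; apply: dom_act.
  pose new : set cell :=
    [set c : cell | exists f : mono (projT1 c) n, projT2 c = (act f x, act f y)]%classic.
  have newG k z w : new (@pt k z w) -> dom k z -> G (@pt k z w).
    by move=> [/= f [-> ->]] /G_notonto/not_ontoP/Gb.
  have/(_ (pt x y)) : ((G `|` new) `<=` G)%classic.
    apply: Gmax; first by move=> c; left.
    split=> [k z w w'|k z w|m k g z w].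
    - move=> [Gw|nw] [Gw'|nw'].
      + exact: Gfun Gw Gw'.
      + by apply: (Gfun _ _ _ _ Gw); apply: newG nw' _; exists w.
      + by apply/esym; apply: (Gfun _ _ _ _ Gw'); apply: newG nw _; exists w'.
      + case: (pselect (dom k z)) => [zd|zd].
          by apply: (Gfun _ z); apply: newG.
        case: nw nw' zd => /= f [-> ->] [g /= [e ->]] zd.
        have onto_of (h : mono k n) : act f x = act h x -> onto h.
          by move=> eh; apply: contrapT => /not_ontoP/domb; rewrite -eh.
        congr act; apply: (act_onto_inj dom_act domb) => //; exact: onto_of.
    - by case=> [/Gover //|[f /= [-> ->]]]; rewrite sfun_act py.
    - case=> [/(Gact _ _ g)|[f /= [-> ->]]]; first by left.
      by right; exists (mcomp f g); rewrite /= !act_comp.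
  move=> newxG; apply: ndx; exists y; apply: newxG; right; exists (mid n).
  by rewrite /= !act_id.
pose Ff n x := sval (cid (total n x)).
have FG n x : G (pt x (Ff n x)) by exact: svalP (cid (total n x)).
have Fact m n (f : mono m n) x : Ff m (act f x) = act f (Ff n x).
  by apply: Gfun (FG _ _) _; apply: Gact.
exists (SMap Ff Fact); split; apply: smap_eq => n x /=; first exact: Gover.
apply: Gfun (FG _ _) _; right; exists (svalP x) => /=; congr (a n _).
exact: sig_eq.
Qed.

End SectionExtension.

(** * Partial simplicial maps on the nerve of a finite poset *)

(** Functions that are not monotone are sent to a constant map, so that no proof
    of monotonicity has to be carried along. *)
Definition tomono m n (u : 'I_m.+1 -> 'I_n.+1) : mono m n :=
  insubd (mconst m ord0) (finfun u).

Lemma tomonoE m n (u : 'I_m.+1 -> 'I_n.+1) :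
  (forall i j : 'I_m.+1, i <= j -> u i <= u j) -> forall i, tomono u i = u i.
Proof.
move=> um i; rewrite /tomono /insubd insubT ?mono_subproof // => h /=.
by rewrite ffunE.
Qed.

Lemma tomono_comp k m n (u : 'I_m.+1 -> 'I_n.+1) (g : mono k m) :
  (forall i j : 'I_m.+1, i <= j -> u i <= u j) ->
  tomono (fun i => u (g i)) = mcomp (tomono u) g.
Proof.
move=> um; apply: mono_eq => i; rewrite mcompE !tomonoE // => j j' jj.
exact/um/mono_le.
Qed.

Lemma tomonoK m n (u : mono m n) : tomono u = u.
Proof. by apply: mono_eq => i; rewrite tomonoE //; apply: mono_le. Qed.

Section Poset.
Variables (P : finType) (le : rel P).

Definition increasing k (x : 'I_k.+1 -> P) : Prop :=
  forall i j : 'I_k.+1, i <= j -> le (x i) (x j).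

Definition trace k (x : 'I_k.+1 -> P) : {set P} := [set x i | i : 'I_k.+1]%SET.

Definition chain (s : {set P}) : bool :=
  [forall p in s, forall q in s, le p q || le q p].

Definition down_closed (K : {set {set P}}) : Prop :=
  forall s t : {set P}, s \subset t -> t \in K -> s \in K.

(** The simplicial subset of the nerve of [P] on the simplices whose set of
    vertices belongs to [K]. *)
Definition in_family (K : {set {set P}}) k (x : 'I_k.+1 -> P) : Prop :=
  increasing x /\ trace x \in K.

Lemma chainP (s : {set P}) : reflect {in s &, total le} (chain s).
Proof.
apply: (iffP forall_inP) => [h p q ps qs|h p ps].
  by have /forall_inP := h p ps; apply.
by apply/forall_inP => q qs; apply: h.
Qed.

Lemma chainS (s t : {set P}) : s \subset t -> chain t -> chain s.
Proof.
by move=> /fintype.subsetP st /chainP h; apply/chainP => p q /st pt /st; apply: h.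
Qed.

Lemma mem_trace k (x : 'I_k.+1 -> P) i : x i \in trace x.
Proof. exact: imset_f. Qed.

Lemma traceP k (x : 'I_k.+1 -> P) p : reflect (exists i, p = x i) (p \in trace x).
Proof. by apply: (iffP imsetP) => [[i _ ->]|[i ->]]; exists i. Qed.

Lemma trace_sub k (x : 'I_k.+1 -> P) (s : {set P}) :
  (forall i, x i \in s) <-> trace x \subset s.
Proof.
split=> [h|/fintype.subsetP h i]; last exact/h/mem_trace.
by apply/fintype.subsetP => p /traceP[i ->].
Qed.

Lemma trace_comp m k (x : 'I_k.+1 -> P) (g : 'I_m.+1 -> 'I_k.+1) :
  trace (fun i => x (g i)) \subset trace x.
Proof. by apply/trace_sub => i; apply: mem_trace. Qed.

Lemma chain_trace k (x : 'I_k.+1 -> P) : increasing x -> chain (trace x).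
Proof.
move=> xm; apply/chainP => p q /traceP[i ->] /traceP[j ->]; apply/orP.
by case: (leqP i j) => [|/ltnW] /xm; [left|right].
Qed.

Lemma in_family_comp K m k (x : 'I_k.+1 -> P) (g : mono m k) :
  down_closed K -> in_family K x -> in_family K (fun i => x (g i)).
Proof.
move=> Kd [xm xK]; split; first by move=> i j /(mono_le g); apply: xm.
exact: Kd (trace_comp _ _) xK.
Qed.

Lemma in_familyS (K L : {set {set P}}) k (x : 'I_k.+1 -> P) :
  K \subset L -> in_family K x -> in_family L x.
Proof. by move=> /fintype.subsetP KL [xm /KL]. Qed.

Lemma down_closedU K L : down_closed K -> down_closed L -> down_closed (K :|: L).
Proof.
by move=> Kd Ld s t st; rewrite !inE => /orP[/(Kd _ _ st)|/(Ld _ _ st)] ->;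
  rewrite ?orbT.
Qed.

Section PartialMaps.
Variable C : sSet.

(** A map defined on the simplicial subset of the nerve of [P] given by a family
    [K] is encoded as a function on all vertex sequences, of which only the
    values on the simplices of [K] matter. *)
Definition pmap := forall k, ('I_k.+1 -> P) -> C k.

Definition natural_on K (f : pmap) : Prop :=
  forall m k (g : mono m k) (x : 'I_k.+1 -> P), in_family K x ->
  f m (fun i => x (g i)) = act g (f k x).

Definition agree K (f f' : pmap) : Prop :=
  forall k (x : 'I_k.+1 -> P), in_family K x -> f k x = f' k x.

Lemma natural_onS (K L : {set {set P}}) f :
  K \subset L -> natural_on L f -> natural_on K f.
Proof. by move=> KL fL m k g x /(in_familyS KL); apply: fL. Qed.

Lemma agreeS (K L : {set {set P}}) f f' : K \subset L -> agree L f f' -> agree K f f'.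
Proof. by move=> KL ff k x /(in_familyS KL); apply: ff. Qed.

Lemma agree_trans K f f' f'' : agree K f f' -> agree K f' f'' -> agree K f f''.
Proof. by move=> e e' k x h; rewrite e // e'. Qed.

(** The value on a simplex of both families may be computed in either, so the
    rule that prefers [f] is compatible with taking faces of simplices of [B]. *)
Lemma glue (A B : {set {set P}}) (f g : pmap) :
  down_closed A -> down_closed B -> natural_on A f -> natural_on B g ->
  agree (A :&: B) f g ->
  exists h, [/\ natural_on (A :|: B) h, agree A h f & agree B h g].
Proof.
move=> Ad Bd fA gB fg.
pose h : pmap := fun k x => if trace x \in A then f k x else g k x.
have hA : agree A h f by move=> k x [_ xA]; rewrite /h xA.
have hB : agree B h g.
  move=> k x [xm xB]; rewrite /h; case: ifP => // xA; apply: fg.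
  by split=> //; rewrite inE xA.
exists h; split=> // m k e x [xm]; rewrite inE => /orP[xA|xB].
- by rewrite !hA //; [apply: fA|apply: in_family_comp].
- by rewrite !hB //; [apply: gB|apply: in_family_comp].
Qed.

Hypotheses (le_refl : reflexive le) (le_anti : antisymmetric le)
  (le_trans : transitive le).

Definition enumerates (s : {set P}) d (e : 'I_d.+1 -> P) : Prop :=
  trace e = s /\ forall i j : 'I_d.+1, le (e i) (e j) = (i <= j).

Lemma chain_enum (s : {set P}) p0 : p0 \in s -> chain s ->
  exists d (e : 'I_d.+1 -> P), d.+1 = #|s| /\ enumerates s e.
Proof.
move=> p0s /chainP sc; pose l := sort le (fintype.enum s).
have ls : sorted le l.
  by apply: (sort_sorted_in (P := mem s)) => //; apply/allP => p; rewrite mem_enum.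
have lz : size l = #|s| by rewrite size_sort -cardE.
have lu : uniq l by rewrite sort_uniq enum_uniq.
have lm p : (p \in l) = (p \in s) by rewrite mem_sort mem_enum.
have s0 : 0 < #|s| by apply/card_gt0P; exists p0.
have dE : #|s|.-1.+1 = #|s| by rewrite prednK.
exists #|s|.-1, (fun i => nth p0 l i); split=> //.
have isz (i : 'I_(#|s|.-1.+1)) : i < size l by rewrite lz -[#|s| in X in _ < X]dE.
split.
  apply/setP => p; rewrite -lm; apply/traceP/idP => [[i ->]|pl].
    exact: mem_nth.
  have pi : index p l < #|s|.-1.+1 by rewrite dE -lz index_mem.
  by exists (Ordinal pi); rewrite nth_index.
have le_nth (i j : 'I_(#|s|.-1.+1)) : i <= j -> le (nth p0 l i) (nth p0 l j).
  by move=> ij; apply: (sorted_leq_nth le_trans le_refl) => //; rewrite inE.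
move=> i j; apply/idP/idP => [ij|]; last exact: le_nth.
rewrite leqNgt; apply/negP => ji; have := le_nth _ _ (ltnW ji) => ji'.
have /eqP := le_anti (introT andP (conj ij ji')).
by rewrite nth_uniq // => /eqP ij'; rewrite ij' ltnn in ji.
Qed.

Section Attach.
Variables (K : {set {set P}}) (f : pmap) (s : {set P}) (v : P).
Arguments f : clear implicits.
Hypotheses (Kd : down_closed K) (fK : natural_on K f).
Hypotheses (sc : chain s) (vs : v \in s).
Hypotheses (faces : forall w, w \in s -> w != v -> s :\ w \in K)
  (vface : s :\ v \notin K).

(** Stated for all enumerations of [s], so that [attach] applies both to inner
    horns and to the outer horns that have a filler for another reason. *)
Definition horn_fills : Prop :=
  forall d (e : 'I_d.+1 -> P) (k : 'I_d.+1), d.+1 = #|s| -> enumerates s e ->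
  e k = v -> forall h : smap (sub (horn k)) C,
  (forall l u, h l u = f l (fun i => e ((sval u : mono l d) i))) ->
  exists t : smap (Delta d) C, scomp t (sub_incl (horn k)) = h.

Lemma attach_powerset : K :|: powerset s = K :|: [set s; s :\ v].
Proof.
apply/setP => t; rewrite !inE; case tK: (t \in K) => //=.
apply/idP/orP => [ts|[] /eqP ->]; [|exact: subxx|exact: finset.subsetDl].
have tw w : w \in s -> w != v -> w \in t.
  move=> ws wv; apply: contraFT tK => wt; apply: Kd (faces ws wv).
  by rewrite subsetD1 ts wt.
case vt: (v \in t); [left|right]; rewrite finset.eqEsubset.
- rewrite ts; apply/fintype.subsetP => w ws.
  by have [->//|wv] := eqVneq w v; apply: tw.
- rewrite subsetD1 ts vt; apply/fintype.subsetP => w; rewrite !inE => /andP[wv ws].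
  exact: tw.
Qed.

(** The filler of the horn of [s] at [v] is a map on all subsets of [s]. It agrees
    with [f] on those that belong to [K], since such a subset cannot contain the
    missing face [s :\ v] and hence lies in the horn. *)
Lemma attach : horn_fills ->
  exists f', natural_on (K :|: [set s; s :\ v]) f' /\ agree K f' f.
Proof.
move=> fills; have [d [e [ds [es ele]]]] := chain_enum vs sc.
have e_inj : injective e.
  move=> i j ij; apply/val_inj/anti_leq.
  by rewrite -!ele ij !le_refl.
pose r p : 'I_d.+1 := odflt ord0 [pick i | e i == p].
have rK p : p \in s -> e (r p) = p.
  rewrite -es => /traceP[i ->]; rewrite /r; case: pickP => [j /eqP //|].
  by move/(_ i); rewrite eqxx.
have inK l (u : mono l d) : horn (r v) l u -> in_family K (fun i => e (u i)).
  move=> [j [jv uj]]; split.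
    by move=> i i' /(mono_le u); rewrite ele.
  have ej : e j \in s by rewrite -es mem_trace.
  have ejv : e j != v by apply/eqP => ejv; apply: jv; apply: e_inj; rewrite rK.
  apply: Kd (faces ej ejv); apply/trace_sub => i; rewrite !inE -es mem_trace.
  by rewrite andbT; apply/eqP => /e_inj; apply: uj.
pose h0 l (u : sub (horn (r v)) l)   := f l (fun i => e ((sval u : mono l d) i)).
have h0act m l (g : mono m l) (u : sub (horn (r v)) l) :
    h0 m (act g u) = act g (h0 l u).
  rewrite /h0 -fK; last exact: inK (svalP u).
  by congr (f _ _); apply: funext => i; rewrite /= mcompE.
have [t th] := fills d e (r v) ds (conj es ele) (rK _ vs) (SMap h0 h0act)
  (fun _ _ => erefl).
pose f1 : pmap := fun k x => t k (tomono (fun i => r (x i))).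
have rm k (x : 'I_k.+1 -> P) : in_family (powerset s) x ->
    forall i j : 'I_k.+1, i <= j -> r (x i) <= r (x j).
  move=> [xm]; rewrite inE => /trace_sub xs i j ij.
  by rewrite -ele !rK //; apply: xm.
have f1s : natural_on (powerset s) f1.
  by move=> m k g x xs; rewrite /f1 (tomono_comp _ (rm _ _ xs)) -sfun_act.
have sd : down_closed (powerset s).
  by move=> a b ab; rewrite !inE; apply: fintype.subset_trans.
have [|f2 [f2U f2K _]] := glue Kd sd fK f1s; last first.
  by exists f2; split=> //; rewrite -attach_powerset.
move=> k x [xm]; rewrite inE => /andP[xK xs].
have xfam : in_family (powerset s) x by [].
have xh : horn (r v) k (tomono (fun i => r (x i))).
  have /negP : ~ (s :\ v \subset trace x).
    by move=> /(Kd)/(_ xK); rewrite (negPf vface).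
  case/subsetPn => w; rewrite !inE => /andP[wv ws] wx; exists (r w); split.
    by move=> rwv; case/eqP: wv; rewrite -(rK _ ws) rwv rK.
  move=> i; rewrite (tomonoE (rm _ _ xfam)) => rxw; case/negP: wx.
  rewrite -(rK _ ws) -rxw rK ?mem_trace //.
  by move: xs; rewrite inE => /trace_sub.
have := congr1 (fun u : smap (sub (horn (r v))) C => u k (exist _ _ xh)) th.
rewrite /= /f1 => ->; congr (f _ _); apply: funext => i /=.
rewrite (tomonoE (rm _ _ xfam)) rK //.
by move: xs; rewrite inE => /trace_sub.
Qed.

Lemma inner_horn_fills p q : quasicategory C ->
  p \in s -> p != v -> le p v -> q \in s -> q != v -> le v q -> horn_fills.
Proof.
move=> qcatC ps pv lpv qs qv lvq d e k _ [es ele] ek h _; apply: qcatC.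
- move: ps pv lpv; rewrite -es -ek => /traceP[i ->] ik; rewrite ele => lik.
  apply: leq_trans (_ : i < k); first by [].
  by rewrite ltn_neqAle lik andbT; apply: contraNneq ik => /val_inj ->.
- move: qs qv lvq; rewrite -es -ek => /traceP[i ->] ik; rewrite ele => lik.
  apply: leq_trans (_ : k < i) _; last by rewrite -ltnS.
  by rewrite ltn_neqAle lik andbT; apply: contraNneq ik => /val_inj ->.
Qed.

Lemma down_closed_attach : down_closed (K :|: [set s; s :\ v]).
Proof.
rewrite -attach_powerset; apply: down_closedU => // a b ab.
by rewrite !inE; apply: fintype.subset_trans.
Qed.

End Attach.

(** Extension along an inner anodyne inclusion presented by an acyclic matching.
    The chains of [K1] outside of [K0] are paired by adding or removing their
    pivot, an interior vertex. Attaching the pairs by increasing total weight,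
    every face of a chain [s] other than the one opposite to the pivot is present
    when [s] is attached: the upper member of the pair of that face is either the
    face itself or has one vertex of [s] replaced by a lighter one. *)
Lemma extend_matching (K0 K1 : {set {set P}}) (piv : {set P} -> P -> bool)
    (wt : P -> nat) (f : pmap) :
  quasicategory C -> down_closed K0 -> down_closed K1 -> natural_on K0 f ->
  (forall s, s \in K1 -> chain s) -> (forall p, 0 < wt p) ->
  (forall s, s \in K1 -> s \notin K0 -> exists v, piv s v) ->
  (forall s u v, s \in K1 -> s \notin K0 -> piv s u -> piv s v -> u = v) ->
  (forall s v, piv s v = piv (s :\ v) v) ->
  (forall s v, s \in K1 -> s \notin K0 -> piv s v ->
    [/\ v |: s \in K1, s :\ v \notin K0,
        exists p, [/\ p \in s, p != v & le p v] &
        exists q, [/\ q \in s, q != v & le v q]]) ->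
  (forall s v w u, s \in K1 -> s \notin K0 -> piv s v -> v \in s -> w \in s ->
    w != v -> s :\ w \notin K0 -> piv (s :\ w) u ->
    u \in s :\ w \/ wt u < wt w) ->
  exists f', natural_on K1 f' /\ agree K0 f' f.
Proof.
move=> qcatC + K1d + K1c wt0 + + pivD.
move: {2}(#|K1 :\: K0|) (leqnn #|K1 :\: K0|) => N.
elim: N => [|N IH] in K0 f * => KN K0d fK0 piv_ex piv_uniq toggle descend.
  exists f; split=> //; apply: natural_onS fK0.
  by rewrite -finset.setD_eq0 -cards_eq0 -leqn0.
have [K10|] := boolP (K1 \subset K0).
  by exists f; split=> //; apply: natural_onS fK0.
case/subsetPn => s0 s01 s00.
have pivU s v : piv (v |: s) v = piv s v.
  rewrite pivD [RHS]pivD; congr (piv _ v); apply/setP => p; rewrite !inE.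
  by case: eqP.
have notK0 (s t : {set P}) : s \subset t -> s \notin K0 -> t \notin K0.
  by move=> st; apply/contraNN/K0d.
(* The next pair to be attached is one whose upper member has least weight. *)
pose W (s : {set P}) := \sum_(p in s) wt p.
pose top (s : {set P}) := [&& s \in K1, s \notin K0 & [exists v in s, piv s v]].
have top_of s v : s \in K1 -> s \notin K0 -> piv s v -> top (v |: s).
  move=> s1 s0' sv; have [vs1 _ _ _] := toggle _ _ s1 s0' sv.
  rewrite /top vs1 (notK0 _ _ (finset.subsetUr _ _) s0') /=.
  by apply/exists_inP; exists v; rewrite ?setU11 ?pivU.
have [v0 s0v0] := piv_ex _ s01 s00.
have := @arg_minnP _ (v0 |: s0) top W (top_of _ _ s01 s00 s0v0).
case=> s /and3P[s1 sN0 /exists_inP[v vs sv]] smin.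
have [vs1 svN0 [p [ps pv lpv]] [q [qs qv lvq]]] := toggle _ _ s1 sN0 sv.
have faces w : w \in s -> w != v -> s :\ w \in K0.
  move=> ws wv; apply: contrapT => /negP swN0.
  have sw1 : s :\ w \in K1 by apply: K1d s1; apply: finset.subsetDl.
  have [u swu] := piv_ex _ sw1 swN0.
  have := smin _ (top_of _ _ sw1 swN0 swu); rewrite leqNgt => /negP; apply.
  rewrite /W [X in _ < X](big_setD1 w) //=.
  case usw: (u \in s :\ w).
    have -> : u |: s :\ w = s :\ w
      by apply/finset.setUidPr; rewrite finset.sub1set.
    by rewrite addnC -addn1 leq_add2l.
  rewrite big_setU1 ?usw //= ltn_add2r.
  by have [|] := descend _ _ _ _ s1 sN0 sv vs ws wv swN0 swu; rewrite ?usw.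
have [f1 [f1K f1f]] := attach K0d fK0 (K1c _ s1) vs faces svN0
  (inner_horn_fills qcatC ps pv lpv qs qv lvq).
have K0'd := down_closed_attach K0d faces.
have notU t : t \notin K0 :|: [set s; s :\ v] ->
    [/\ t \notin K0, t != s & t != s :\ v].
  by rewrite !inE !negb_or => /and3P.
have [|||||f2 [f2K f2f1]] := IH _ f1 _ K0'd f1K.
- rewrite -ltnS; apply: leq_trans KN; apply: proper_card.
  apply/properP; split; first by apply: finset.setDS; apply: finset.subsetUl.
  by exists s; rewrite !inE ?s1 ?sN0 // eqxx orbT.
- by move=> t t1 /notU[/(piv_ex _ t1)].
- by move=> t u u' t1 /notU[tN0 _ _]; apply: piv_uniq.
- move=> t u t1 /notU[tN0 ts tsv] tu.
  have [ut1 tuN0 ex1 ex2] := toggle _ _ t1 tN0 tu.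
  split=> //; rewrite !inE !negb_or tuN0 /=; apply/andP; split.
  + apply/eqP => tus; have us : u \notin s by rewrite -tus !inE eqxx.
    have uv : u = v by apply: (piv_uniq s) => //; rewrite -tus -pivD.
    by rewrite uv vs in us.
  + have svK1 : s :\ v \in K1 by apply: K1d s1; apply: finset.subsetDl.
    apply/eqP => tus; have uv : u = v.
      by apply: (piv_uniq (s :\ v)) => //; rewrite -?pivD // -tus -pivD.
    move: tus ts tsv; rewrite uv => tus; case vt: (v \in t).
      by rewrite -(finset.setD1K vt) tus finset.setD1K // eqxx.
    by rewrite -tus (finset.setDidPl _) ?eqxx // disjoint_sym disjoints1 vt.
- move=> t u w u' t1 /notU[tN0 _ _] tu ut wt' wu /notU[twN0 _ _].
  exact: (descend _ u).
exists f2; split=> //; apply: agree_trans f1f.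
by apply: agreeS f2f1; apply: finset.subsetUl.
Qed.

End PartialMaps.
End Poset.

(** * Outer horns whose first edge is degenerate *)

(** An edge that is degenerate is its own inverse, and an elementary argument
    replaces the general theory of invertible edges. Let the degenerate edge run
    from [x] to [y], and let [Z] be the set of the other vertices of the simplex.
    The two ends are duplicated: the chain [t0 < t1 < t2 < t3], below [Z], lies over
    [x], [y], [x], [y]. The map is constant on the chains without a vertex of [Z].
    The horn prescribes it on the chains in [t0, t2, t3] and in [t1, t3] as long as
    a vertex of [Z] is missing, and on those in [t0, t2] without restriction. Inner
    horns at [t3] and [t2] extend it to all chains that miss a vertex of [Z]. Over
    the whole of [Z], the inner horn at [t2] of [t1, t2] carries the cone with
    vertex [t2] back to a cone with vertex [t1], and then that of [t0, t1, t2]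
    produces [t0, t1]. The cone with vertex [t3] is defined as the copy of the one
    with vertex [t1], and the inner horn at [t1] of [t0, t1, t3] supplies
    [t0, t3], which is a filler of the given horn. *)
Module SpecialHorn.
Section SpecialHorn.
Variables (C : sSet) (N : nat).
Hypothesis qcatC : quasicategory C.
Notation M := N.+2.
Variable h : smap (sub (horn (ord0 : 'I_M.+1))) C.

Definition vertex1 : 'I_M.+1 := @Ordinal M.+1 1 isT.

Lemma const0_in_horn k : horn ord0 k (mconst k (ord0 : 'I_M.+1)).
Proof. by exists vertex1; split=> // i; rewrite mconstE. Qed.

Definition horn_point k : C k := h k (exist _ _ (@const0_in_horn k)).

Hypothesis first_edge_degenerate :
  forall k (u u' : sub (horn (ord0 : 'I_M.+1)) k),
  (forall i, (sval u : mono k M) i <= 1) ->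
  (forall i, (sval u' : mono k M) i <= 1) -> h k u = h k u'.

Definition total_horn k (u : mono k M) : C k :=
  if pselect (horn ord0 k u) is left p then h k (exist _ u p) else horn_point k.

Lemma total_hornE k (u : sub (horn (ord0 : 'I_M.+1)) k) : total_horn (sval u) = h k u.
Proof.
rewrite /total_horn; case: pselect => [p|[]]; last exact: svalP u.
by congr (h k _); apply: sig_eq.
Qed.

Lemma horn_point_act m k (g : mono m k) : horn_point m = act g (horn_point k).
Proof.
rewrite /horn_point -sfun_act; congr (h m _); apply: sig_eq.
by rewrite /= mcomp_const.
Qed.

(** The left summand consists of [t0], ..., [t3], the right one is [Z]. *)
Definition T : finType := ('I_4 + 'I_N.+1)%type.
Definition t0 : T := inl (@Ordinal 4 0 isT).
Definition t1 : T := inl (@Ordinal 4 1 isT).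
Definition t2 : T := inl (@Ordinal 4 2 isT).
Definition t3 : T := inl (@Ordinal 4 3 isT).

Definition le (p q : T) : bool :=
  match p, q with
  | inl i, inl j => i <= j
  | inl _, inr _ => true
  | inr _, inl _ => false
  | inr i, inr j => i <= j
  end.

Lemma le_refl : reflexive le. Proof. by case=> i /=; apply: leqnn. Qed.
Lemma le_anti : antisymmetric le.
Proof. by case=> i [] j //= /anti_leq/val_inj ->. Qed.
Lemma le_trans : transitive le.
Proof. by case=> i [] j [] l //=; apply: leq_trans. Qed.
Lemma le_chain s : chain le s.
Proof. by apply/chainP; case=> i [] j _ _ //=; apply: leq_total. Qed.

Lemma inlP (i : 'I_4) : [\/ inl i = t0, inl i = t1, inl i = t2 | inl i = t3].
Proof.
by case: i => [[|[|[|[|//]]]] i4];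
  [constructor 1|constructor 2|constructor 3|constructor 4];
  congr inl; apply: val_inj.
Qed.

Definition all_z (s : {set T}) : bool := [forall j : 'I_N.+1, inr j \in s].
Definition no_z (s : {set T}) : bool := [forall j : 'I_N.+1, inr j \notin s].

(** The chains on which the map is prescribed: those without a vertex of [Z], on
    which it is constant, those in [t0, t2, t3] or in [t1, t3] over a proper subset
    of [Z], and those in [t0, t2] over the whole of [Z]. *)
Definition start : {set {set T}} := [set s : {set T} | no_z s ||
  (if all_z s then (t1 \notin s) && (t3 \notin s)
   else (t1 \notin s) || (t0 \notin s) && (t2 \notin s))]%SET.

(** What is reached before the cone with vertex [t3] is chosen. *)
Definition middle : {set {set T}} := [set s : {set T} | ~~ all_z s || (t3 \notin s)]%SET.

(** The chains on which [t3] is treated as a copy of [t1]. *)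
Definition mirror : {set {set T}} := [set s : {set T} | (t0 \notin s) && (t2 \notin s)]%SET.

Lemma all_zS (s t : {set T}) : s \subset t -> all_z s -> all_z t.
Proof. by move=> /fintype.subsetP st /forallP sZ; apply/forallP => j; apply/st/sZ. Qed.
Lemma no_zS (s t : {set T}) : s \subset t -> no_z t -> no_z s.
Proof.
move=> /fintype.subsetP st /forallP sZ; apply/forallP => j.
by apply: contra (sZ j) => /st.
Qed.

Lemma start_down : down_closed start.
Proof.
move=> s t st; have n p : p \notin t -> p \notin s.
  by apply: contra; apply/fintype.subsetP.
rewrite !inE => /orP[/(no_zS st) -> //|].
case ft: (all_z t).
  move=> /andP[/n -> /n ->]; by case: ifP; rewrite orbT.
rewrite (contraFF (all_zS st) ft).
by case/orP=> [/n ->|/andP[/n -> /n ->]]; rewrite ?orbT.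
Qed.

Lemma middle_down : down_closed middle.
Proof.
move=> s t st; rewrite !inE => /orP[|n].
  by move/(contra (all_zS st)) => ->.
by apply/orP; right; apply: contra n; apply/fintype.subsetP.
Qed.

Lemma mirror_down : down_closed mirror.
Proof.
move=> s t st; rewrite !inE => /andP[n n'].
by apply/andP; split; [apply: contra n|apply: contra n']; apply/fintype.subsetP.
Qed.

Definition project (p : T) : 'I_M.+1 :=
  match p with
  | inl i => if odd i then vertex1 else ord0
  | inr j => lift ord0 (lift ord0 j)
  end.

Definition is_t (p : T) : bool := if p is inl _ then true else false.

Definition start_map : pmap T C := fun k x =>
  if [forall i, is_t (x i)] then horn_point k
  else total_horn (tomono (fun i => project (x i))).

Lemma start_map_horn k (x : 'I_k.+1 -> T) : in_family le start x ->
  ~~ [forall i, is_t (x i)] ->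
  (forall i j : 'I_k.+1, i <= j -> project (x i) <= project (x j)) /\
  horn ord0 k (tomono (fun i => project (x i))).
Proof.
case=> xm; rewrite inE => + /forallPn[i0 xi0].
have /negPf -> /= : ~~ no_z (trace x).
  apply/forallPn; move: xi0; case xE: (x i0) => [//|j] _.
  by exists j; rewrite negbK -xE mem_trace.
have xt i : x i \in trace x by apply: mem_trace.
move=> xK; have mon : forall i j : 'I_k.+1, i <= j -> project (x i) <= project (x j).
  move=> i j /xm.
  have key : (t1 \notin trace x) || (t0 \notin trace x) && (t2 \notin trace x).
    by move: xK; case: ifP => // _ /andP[-> _].
  move: (xt i) (xt j); case: (x i) (x j) => [a|a] [b|b].
  - by case: (inlP a) (inlP b) => -> [] -> xa xb //; rewrite xa xb ?andbF in key.
  - by move=> _ _ _ /=; case: ifP.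
  - by [].
  - by [].
split=> //; move: xK; case: ifP => [_ /andP[n1 n3]|/negbT/forallPn[j xj] _].
  exists vertex1; split=> // i; rewrite tomonoE //; move: (xt i).
  case: (x i) => [a|b]; last by move=> _ /(congr1 val).
  by case: (inlP a) => -> xa; rewrite ?xa // in n1 n3 *; move=> /(congr1 val).
exists (lift ord0 (lift ord0 j)); split; first by move/(congr1 val).
move=> i; rewrite tomonoE //; move: (xt i).
case: (x i) => [a|b] xa; first by rewrite /=; case: ifP => _ /(congr1 val).
by move=> /lift_inj/lift_inj jb; rewrite -jb xa in xj.
Qed.

Lemma total_horn_act m k (g : mono m k) (u : mono k M) : horn ord0 k u ->
  total_horn (mcomp u g) = act g (total_horn u).
Proof.
move=> uh; rewrite (total_hornE (exist _ u uh)) -sfun_act.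
by rewrite -(total_hornE (act g (exist _ u uh : sub (horn ord0) k))).
Qed.

Lemma total_horn_low k (u : mono k M) : (forall i, u i <= 1) -> total_horn u = horn_point k.
Proof.
move=> low; rewrite /total_horn; case: pselect => // p.
by apply: first_edge_degenerate => //= i; rewrite mconstE.
Qed.

Lemma start_map_natural : natural_on le start start_map.
Proof.
move=> m k g x xK; rewrite /start_map; case: ifP => [/forallP xl|/negbT xl].
  case: ifP => [_|/negbT/start_map_horn [] // phim uh]; first exact: horn_point_act.
  rewrite -total_horn_act // -tomono_comp //; apply/esym/total_horn_low => i.
  rewrite tomonoE => [|j j' /(mono_le g)]; last exact: phim.
  by move: (xl i); case: (x (g i)) => //= a _; case: ifP.
have /negPf -> : ~~ [forall i, is_t (x i)].
  by apply: contra xl => /forallP xl; apply/forallP.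
have [|phim uh] := start_map_horn xK.
  by apply: contra xl => /forallP xl; apply/forallP.
by rewrite -total_horn_act // -tomono_comp.
Qed.

(** Over a proper subset of [Z], the chain [t1, t2] is paired with [t1, t2, t3],
    [t0, t1] with [t0, t1, t2], and [t0, t1, t3] with the whole of [t0, ..., t3];
    over [Z], [t1] is paired with [t1, t2], and [t0, t1] with [t0, t1, t2]. *)
Definition toggle (s : {set T}) (v : T) : bool :=
  (v == t3) && [&& ~~ all_z s, t0 \notin s, t1 \in s & t2 \in s] ||
  (v == t2) && (t1 \in s) && (all_z s || (t0 \in s)).

(** Vertices of [Z] are heaviest, so that smaller subsets of [Z] come first, and
    [t0] is heavier than [t3] because the face [t1, t2] of [t0, t1, t2] is paired
    with [t1, t2, t3]. *)
Definition wt (p : T) : nat := if p is inl i then (if p == t0 then 2 else 1) else 3.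

Lemma all_zD (s : {set T}) i : all_z (s :\ inl i) = all_z s.
Proof. by apply: eq_forallb => j; rewrite !inE. Qed.
Lemma no_zD (s : {set T}) i : no_z (s :\ inl i) = no_z s.
Proof. by apply: eq_forallb => j; rewrite !inE. Qed.
Lemma all_zU (s : {set T}) i : all_z (inl i |: s) = all_z s.
Proof. by apply: eq_forallb => j; rewrite !inE. Qed.

Lemma extend_to_middle :
  exists f1, natural_on le middle f1 /\ agree le start f1 start_map.
Proof.
apply: (extend_matching le_refl le_anti le_trans (piv := toggle) (wt := wt)
  qcatC start_down middle_down start_map_natural (fun s _ => le_chain s)).
- by case=> i //; rewrite /wt; case: eqP.
- move=> s; rewrite !inE negb_or /toggle => + /andP[_].
  case fs: (all_z s); rewrite /= ?negb_and ?negbK.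
    by move=> /negPf ->; rewrite orbF => s1; exists t2; rewrite s1 !eqxx ?orbT.
  move=> _; rewrite negb_or negbK negb_and !negbK => /andP[s1].
  case s0: (t0 \in s); rewrite /= => s2; first by exists t2; rewrite s1 !eqxx orbT.
  by exists t3; rewrite s1 s2.
- move=> s u v _ _ /orP[/andP[/eqP -> /and4P[nf n0 _ _]]|/andP[/andP[/eqP -> _ uu]]]
    /orP[/andP[/eqP -> /and4P[nf' n0' _ _]]|/andP[/andP[/eqP -> _ uu']]] //.
  + by rewrite (negPf nf) (negPf n0) in uu'.
  + by rewrite (negPf nf') (negPf n0') in uu.
- move=> s v; rewrite /toggle.
  have [->|v3] := eqVneq v t3; first by rewrite all_zD !inE.
  by have [->|] := eqVneq v t2; rewrite //= all_zD !inE.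
- move=> s v; rewrite !inE negb_or => s1 /andP[nZ sK0] sv.
  have s1v : t1 \in s by case/orP: sv => [/andP[_ /and4P[]]|/andP[/andP[]]].
  have vl : v = t2 \/ v = t3.
    by case/orP: sv => [/andP[/eqP]|/andP[/andP[/eqP]]]; [right|left].
  have v1 : t1 != v by case: vl => ->.
  have lv : le t1 v by case: vl => ->.
  move/forallPn: (nZ) => [j]; rewrite negbK => js; split.
  + case/orP: sv => [/andP[/eqP -> /and4P[nf _ _ _]]|/andP[/andP[/eqP -> _ _]]].
      by rewrite all_zU nf.
    by rewrite all_zU.
  + case/orP: sv => [/andP[/eqP -> /and4P[nf _ _ s2]]|/andP[/andP[/eqP -> _ fs0]]].
      by rewrite no_zD all_zD (negPf nZ) (negPf nf) s1v s2 andbF.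
    rewrite no_zD all_zD (negPf nZ) s1v /=.
    by case: ifP fs0 => //= _ ->.
  + by exists t1.
  + exists (inr j); split=> //; by case: vl => ->.
- move=> s v w u; rewrite !inE negb_or => s1 /andP[nZ sK0] sv vs ws wv + swu.
  have u_light : wt u = 1.
    by case/orP: swu => [/andP[/eqP ->]|/andP[/andP[/eqP ->]]].
  case: w ws wv swu => [i|j] ws wv swu; last by right; rewrite u_light.
  rewrite no_zD all_zD (negPf nZ) /=; move: wv ws swu.
  case: (inlP i) => ->; rewrite /toggle all_zD ?inE //= => wv ws swu.
  + by right; rewrite u_light.
  + by case/orP: swu => /andP[]; rewrite ?andbF.
  + case/orP: sv => [/andP[/eqP vE /and4P[nf n0 _ _]]|/andP[/andP[/eqP vE]]].
      by rewrite (negPf nf) n0 /= orbT.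
    by rewrite vE eqxx in wv.
  + case/orP: sv => [/andP[/eqP vE _]|/andP[/andP[/eqP vE _ fs0]]].
      by rewrite vE eqxx in wv.
    move=> _; left; rewrite vE in vs.
    case/orP: swu => [/and5P[_ nf n0 _ _]|/andP[/andP[/eqP -> _ _]]].
      by rewrite (negPf nf) (negPf n0) in fs0.
    by rewrite vs.
Qed.

Definition retract (p : T) : T := if p == t3 then t1 else p.

Lemma retract_le p q : p \notin [set t0; t2]%SET -> q \notin [set t0; t2]%SET ->
  le p q -> le (retract p) (retract q).
Proof.
case: p q => [i|i] [j|j] //; last by case: (inlP i) => ->.
by case: (inlP i) (inlP j) => -> [] ->; rewrite // !inE.
Qed.

Lemma in_mirror k (x : 'I_k.+1 -> T) : in_family le mirror x ->
  forall i, x i \notin [set t0; t2]%SET.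
Proof.
case=> _; rewrite inE => /andP[n0 n2] i; rewrite !inE negb_or.
by apply/andP; split; apply/eqP => xi; [move: n0|move: n2]; rewrite -xi mem_trace.
Qed.

Lemma retract_middle k (x : 'I_k.+1 -> T) : in_family le mirror x ->
  in_family le middle (fun i => retract (x i)).
Proof.
move=> xA; case: (xA) => xm _; split.
  by move=> i j ij; apply: retract_le (xm _ _ ij); apply: in_mirror.
rewrite inE; apply/orP; right; apply/traceP => -[i]; rewrite /retract.
by case: eqP => // n /esym.
Qed.

Lemma start_map_retract k (x : 'I_k.+1 -> T) :
  in_family le mirror x -> start_map (fun i => retract (x i)) = start_map x.
Proof.
move=> xA; rewrite /start_map.
have -> : (fun i => project (retract (x i))) = (fun i => project (x i)).
  by apply: funext => i; rewrite /retract; case: eqP => // ->.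
congr (if _ then _ else _); apply: eq_forallb => i.
by rewrite /retract; case: eqP => // ->.
Qed.

Lemma extend_to_mirror :
  exists f2, natural_on le (middle :|: mirror) f2 /\ agree le start f2 start_map.
Proof.
have [f1 [f1K1 f10]] := extend_to_middle.
pose g : pmap T C := fun k x => f1 k (fun i => retract (x i)).
have gA : natural_on le mirror g.
  by move=> m k e x /retract_middle; apply: f1K1.
have [|f2 [f2U f2K1 _]] := glue middle_down mirror_down f1K1 gA.
  move=> k x [xm]; rewrite finset.inE => /andP[xK1 xA].
  rewrite /g; case t3x: (t3 \in trace x); last first.
    congr (f1 _ _); apply: funext => i; rewrite /retract; case: eqP => // xi.
    by rewrite -xi mem_trace in t3x.
  have xAm : in_family le mirror x by [].
  move: (xA) (xK1); rewrite !inE t3x orbF => /andP[n0 n2] nf.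
  have xK0 : in_family le start x.
    by split=> //; rewrite inE (negPf nf) n0 n2 !orbT.
  have cK0 : in_family le start (fun i => retract (x i)).
    have [cm _] := retract_middle xAm.
    split=> //; rewrite inE.
    have -> : all_z (trace (fun i => retract (x i))) = all_z (trace x).
      apply: eq_forallb => j; apply/traceP/traceP => -[i ji]; exists i.
        by move: ji; rewrite /retract; case: eqP.
      by rewrite /retract -ji.
    rewrite (negPf nf); apply/orP; right; apply/orP; right.
    apply/andP; split; apply/traceP => -[i]; rewrite /retract;
      case: eqP => [_ //|_ xi].
      by rewrite xi mem_trace in n0.
    by rewrite xi mem_trace in n2.
  by rewrite !f10 // start_map_retract.
exists f2; split=> // k x xK0; rewrite f2K1 ?f10 //; apply: in_familyS xK0.
apply/fintype.subsetP => s; rewrite !inE => /orP[/forallP/(_ ord0) n|].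
  by apply/orP; left; apply/forallPn; exists ord0.
by case: (all_z s) => //= /andP[].
Qed.

Lemma special_horn_fills :
  exists t : smap (Delta M) C, scomp t (sub_incl (horn ord0)) = h.
Proof.
have [f2 [f2U f20]] := extend_to_mirror.
(* The last cell is attached at [t1]; its missing face is [t0, t3] over [Z]. *)
pose s : {set T} := [set~ t2]%SET.
have Z_s w j : inr j \in s :\ inl w by rewrite !inE.
have [t0s t1s t3s] : [/\ t0 \in s, t1 \in s & t3 \in s] by rewrite !inE.
have faces w : w \in s -> w != t1 -> s :\ w \in middle :|: mirror.
  rewrite !inE; case: w => [i|j].
    by case: (inlP i) => -> // _ _; rewrite ?eqxx ?orbT.
  move=> _ _; apply/orP; left; apply/orP; left; apply/forallPn; exists j.
  by rewrite !inE eqxx.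
have face1 : s :\ t1 \notin middle :|: mirror.
  rewrite !inE /= orbF negb_or !negbK andbT.
  by apply/forallP => j; apply: Z_s.
have [f3 [f3U f32]] := attach le_refl le_anti le_trans
  (down_closedU middle_down mirror_down) f2U (le_chain s) t1s faces face1
  (@inner_horn_fills _ le _ f2 s t1 t0 t3 qcatC t0s isT isT t3s isT isT).
have K3d := down_closed_attach (down_closedU middle_down mirror_down) faces.
(* The standard simplex is embedded on [t0], [t3] and [Z]. *)
pose eps (a : 'I_M.+1) : T := if unlift ord0 a is Some b then
  (if unlift ord0 b is Some j then inr j else t3) else t0.
have epsK a : project (eps a) = a.
  rewrite /eps; case: unliftP => [b ->|-> //]; case: unliftP => [j -> //|->].
  exact: val_inj.
have eps_le (a b : 'I_M.+1) : a <= b -> le (eps a) (eps b).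
  rewrite /eps; case: (unliftP ord0 a) => [a' ->|->]; case: (unliftP ord0 b) => [b' ->|->] //=.
    rewrite leq_bump2; case: (unliftP ord0 a') => [a'' ->|->];
      case: (unliftP ord0 b') => [b'' ->|->] //=; by rewrite leq_bump2.
  by case: (unliftP ord0 b') => [b'' ->|->].
have eps_s k (u : mono k M) :
    in_family le (middle :|: mirror :|: [set s; s :\ t1]) (fun i => eps (u i)).
  split; first by move=> i j /(mono_le u); apply: eps_le.
  apply: (K3d _ (s :\ t1)); last by apply/setUP; right; apply/set2P; right.
  apply/trace_sub => i; rewrite /eps; case: unliftP => [b _|_]; last by rewrite !inE.
  by case: unliftP => [j _|_]; rewrite ?Z_s // !inE.
have tact m k (g : mono m k) (u : Delta M k) :
    f3 m (fun i => eps (mcomp u g i)) = act g (f3 k (fun i => eps (u i))).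
  rewrite -f3U //; congr (f3 _ _); apply: funext => i; by rewrite mcompE.
exists (@SMap (Delta M) C (fun k u => f3 k (fun i => eps (u i))) tact).
apply: smap_eq => k [u uh] /=; have [um _] := eps_s k u.
have uK0 : in_family le start (fun i => eps (u i)).
  split=> //; rewrite inE; case nZ: (no_z _) => //=.
  have n1 : t1 \notin trace (fun i => eps (u i)).
    apply/traceP => -[i]; rewrite /eps; case: unliftP => // b _.
    by case: unliftP.
  rewrite n1 /=; case: ifP => // fZ; apply/traceP => -[i ui].
  have [j [j0 uj]] := uh; move/forallP: fZ.
  case: (unliftP ord0 j) j0 => [j' jE _|//].
  case: (unliftP ord0 j') jE => [j'' -> jE|-> jE].
    by move=> /(_ j'')/traceP[i' ui']; case: (uj i'); rewrite -[u i']epsK -ui' jE.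
  by move=> _; case: (uj i); rewrite -[u i]epsK -ui jE; apply: val_inj.
have xK1A : in_family le (middle :|: mirror) (fun i => eps (u i)).
  apply: in_familyS uK0; apply/fintype.subsetP => t.
  rewrite !inE => /orP[/forallP/(_ ord0) n|].
    by apply/orP; left; apply/orP; left; apply/forallPn; exists ord0.
  by case: (all_z t) => //= /andP[_ ->].
rewrite f32 // f20 // /start_map; case: ifP => [/forallP ul|_].
  apply: first_edge_degenerate => i /=; first by rewrite mconstE.
  move: (ul i).
  rewrite -{2}[u i]epsK; case: (eps (u i)) => // a _ /=.
  by case: ifP.
have -> : tomono (fun i => project (eps (u i))) = u.
  by rewrite -[RHS]tomonoK; congr tomono; apply: funext.
exact: (total_hornE (exist _ u uh)).
Qed.

End SpecialHorn.
End SpecialHorn.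

(** * Simplices of the join with a standard simplex *)

Section JoinDelta.
Variable K : sSet.

(** The initial part of the cut is sent to level 0, which makes the level a
    monotone function on all vertices. *)
Definition level n l (y : join K (Delta n) l) (i : 'I_l.+1) : 'I_n.+1 :=
  match cut y i =P ord_max with
  | ReflectT e => (back y 0 (exist _ (mconst 0 i)
      (etrans (mcomp_constr 0 i (cut y)) (congr1 (@mconst 0 1) e))) : mono 0 n)
      ord0
  | ReflectF _ => ord0
  end.

Lemma level_back n l (y : join K (Delta n) l) k (f : mono k l) h i :
  level y (f i) = (back y k (exist _ f h) : mono k n) i.
Proof.
rewrite /level; case: eqP => [e|]; last by case; rewrite -mcompE h mconstE.
set w := exist _ _ _.
have -> : w = act (mconst 0 i) (exist _ f h : sub (fiber (cut y) ord_max) k).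
  by apply: sig_eq; rewrite /= mcomp_constr.
by rewrite sfun_act [LHS]mcompE mconstE.
Qed.

Lemma level_front n l (y : join K (Delta n) l) i :
  cut y i <> ord_max -> level y i = ord0.
Proof. by rewrite /level; case: eqP. Qed.

Lemma level_mono n l (y : join K (Delta n) l) (i j : 'I_l.+1) :
  i <= j -> level y i <= level y j.
Proof.
move=> ij; have [yi|/level_front -> //] := pselect (cut y i = ord_max).
have fP (a b : 'I_2) : a <= b ->
    (if a == ord0 then i else j) <= (if b == ord0 then i else j).
  by case: (ord2P a) (ord2P b) => -> [] ->.
pose f : mono 1 l := mkmono fP.
have h : fiber (cut y) ord_max 1 f.
  apply: mono_eq => a; rewrite mcompE mkmonoE mconstE; case: ifP => // _.
  case: (ord2P (cut y j)) => // yj.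
  by have := mono_le (cut y) ij; rewrite yi yj.
have := mono_le (back y 1 (exist _ f h) : mono 1 n)
  (leq0n (ord_max : 'I_2) : (ord0 : 'I_2) <= (ord_max : 'I_2)).
by rewrite -!level_back !mkmonoE.
Qed.

Definition mlevel n l (y : join K (Delta n) l) : mono l n :=
  mkmono (@level_mono n l y).

Lemma level_act n m l (g : mono m l) (y : join K (Delta n) l) i :
  level (act g y) i = level y (g i).
Proof.
have [e|ne] := pselect (cut y (g i) = ord_max); last first.
  by rewrite !level_front //= mcompE.
have h : fiber (cut (act g y)) ord_max 0 (mconst 0 i).
  by rewrite /= mcomp_constr mcompE e.
rewrite -[i in LHS](mconstE i (ord0 : 'I_1)) (level_back h) /= -level_back mcompE.
by rewrite mconstE.
Qed.

Lemma join_mapr_comp m n p (g : mono n p) (f : mono m n) l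
    (y : join K (Delta m) l) :
  join_mapr K (Delta_map (mcomp g f)) l y =
  join_mapr K (Delta_map g) l (join_mapr K (Delta_map f) l y).
Proof.
apply: join_eq => [|k u hx hy|k u hx hy] //=.
  by congr (front y k _); apply: sig_eq.
by rewrite mcompA; congr (mcomp g (mcomp f (back y k _))); apply: sig_eq.
Qed.

(** Every simplex of a join with a standard simplex is the image of one of these,
    whose final part is tautological ([join_taut]). *)
Definition taut_join k (c : mono k 1) (u : smap (sub (fiber c ord0)) K) :
  join K (Delta k) k := @JoinSimplex K (Delta k) k c u (sub_incl (fiber c ord_max)).

Lemma join_taut n l (y : join K (Delta n) l) :
  join_mapr K (Delta_map (mlevel y)) l (taut_join (front y)) = y.
Proof.
apply: join_eq => [|k f hx hy|k f hx hy] //=.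
  by congr (front y k _); apply: sig_eq.
by apply: mono_eq => i; rewrite mcompE mkmonoE (level_back hy).
Qed.

Lemma taut_join_act m k (g : mono m k) (c : mono k 1)
    (u : smap (sub (fiber c ord0)) K) :
  act g (taut_join u) = join_mapr K (Delta_map g) m
    (taut_join (scomp u (fiber_map c g ord0))).
Proof.
apply: join_eq => [|j f hx hy|j f hx hy] //=.
by congr (u j _); apply: sig_eq.
Qed.

Lemma taut_join_congr n k (d d' : mono k n) (c : mono k 1)
    (u : smap (sub (fiber c ord0)) K) :
  (forall i, c i = ord_max -> d i = d' i) ->
  join_mapr K (Delta_map d) k (taut_join u) =
  join_mapr K (Delta_map d') k (taut_join u).
Proof.
move=> dd; apply: join_eq => [|j f hx hy|j f hx hy] //=.
  by congr (u j _); apply: sig_eq.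
apply: mono_eq => i; rewrite !mcompE; apply: dd.
by rewrite -mcompE hx mconstE.
Qed.

Lemma level_mapr m n (d : mono m n) l (y : join K (Delta m) l) i :
  level (join_mapr K (Delta_map d) l y) i =
  if cut y i == ord_max then d (level y i) else ord0.
Proof.
case: eqP => [e|ne]; last by rewrite level_front.
have h : fiber (cut y) ord_max 0 (mconst 0 i) by rewrite /= mcomp_constr e.
rewrite -(mconstE i (ord0 : 'I_1)).
rewrite (@level_back _ _ (join_mapr K (Delta_map d) l y) _ _ h) (level_back h).
by rewrite [LHS]mcompE.
Qed.

Lemma level_taut k (c : mono k 1) (u : smap (sub (fiber c ord0)) K) i :
  level (taut_join u) i = if c i == ord_max then i else ord0.
Proof.
case: eqP => [e|ne]; last by rewrite level_front.
have h : fiber c ord_max 0 (mconst 0 i) by rewrite /= mcomp_constr e.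
rewrite -[in LHS](mconstE i (ord0 : 'I_1)).
by rewrite (@level_back _ _ (taut_join u) _ _ h) /= mconstE.
Qed.

(** A map into a slice evaluated at a simplex of a join depends on the simplex
    of the source only along the final part of the cut: both sides are computed
    after precomposing with the retraction of [k] onto that part. *)
Lemma slice_taut_congr (C : sSet) (p : smap K C) n (A : Defs.subset (Delta n))
    (b : smap (sub A) (slice p)) k (d d' : sub A k) (c : mono k 1)
    (u : smap (sub (fiber c ord0)) K) :
  (forall i, c i = ord_max -> (sval d : mono k n) i = (sval d' : mono k n) i) ->
  sval (b k d) k (taut_join u) = sval (b k d') k (taut_join u).
Proof.
move=> dd; case: (pickP (fun i => c i == ord_max)) => [i1 ci1|nc].
  pose i0 := [arg min_(i < i1 | c i == ord_max) (i : nat)].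
  have [ci0 i0_min] : c i0 = ord_max /\ forall i, c i = ord_max -> i0 <= i.
    by rewrite /i0; case: arg_minnP => // i /eqP ci imin; split=> // j /eqP /imin.
  (* The retraction onto the final part of the cut, which starts at [i0]. *)
  pose r (i : 'I_k.+1) := if i <= i0 then i0 else i.
  have rm (i j : 'I_k.+1) : i <= j -> r i <= r j.
    rewrite /r => ij; case: (leqP i i0) => ii0; case: (leqP j i0) => ji0 //.
      exact: ltnW.
    by have := leq_trans ii0 (leq_trans ij ji0); rewrite ltnn.
  have rE i : c i = ord_max -> r i = i.
    move=> /i0_min i0i; rewrite /r; case: leqP => // ii0.
    by apply/val_inj/eqP; rewrite eqn_leq i0i.
  have cr i : c (r i) = ord_max.
    rewrite /r; case: leqP => // /ltnW /(mono_le c); rewrite ci0.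
    by case: (ord2P (c i)) => ->.
  have eval (e : sub A k) : sval (b k e) k (taut_join u) =
      sval (b k (act (mkmono rm) e)) k (taut_join u).
    rewrite sfun_act /=; congr (sval (b k e) k _).
    have mid_r : join_mapr K (Delta_map (mid k)) k (taut_join u) = taut_join u.
      apply: join_eq => [|j f hx hy|j f hx hy] //=.
        by congr (u j _); apply: sig_eq.
      by apply: mono_eq => i; rewrite mcompE midE.
    rewrite -[LHS]mid_r; apply: taut_join_congr => i /rE ri.
    by rewrite mkmonoE midE ri.
  rewrite eval [RHS]eval; congr (sval (b k _) k _); apply: sig_eq.
  by apply: mono_eq => i; rewrite !mcompE mkmonoE; apply: dd.
(* If the final part is empty, then the simplex lies in [K] and both sides are
   computed by [p]. *)
have c0 : c = mconst k ord0.
  apply: mono_eq => i; rewrite mconstE; case: (ord2P (c i)) => // ci.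
  by have := nc i; rewrite ci eqxx.
have hid : fiber c ord0 k (mid k) by rewrite /= mcomp1.
have tE : taut_join u = join_inl K (Delta k) k (u k (exist _ (mid k) hid)).
  apply: join_eq => [|j f hx hy|j f hx hy] //=.
    rewrite -sfun_act; congr (u j _); apply: sig_eq => /=.
    by apply: mono_eq => i; rewrite mcompE midE.
  by case: (const_fiberF ord0max hy).
have ext (q : slice p k) z : sval q k (join_inl K (Delta k) k z) = p k z.
  exact: (congr1 (fun v : smap K C => v k z) (svalP q)).
by rewrite tE !ext.
Qed.

End JoinDelta.

(** * Pushout squares as extension problems *)

Definition vert n : finType := ('I_2 * 'I_2 * 'I_n.+1)%type.

Definition vle n (p q : vert n) : bool :=
  [&& p.1.1 <= q.1.1, p.1.2 <= q.1.2 & p.2 <= q.2].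

Lemma vle_refl n : reflexive (@vle n).
Proof. by move=> p; rewrite /vle !leqnn. Qed.

Lemma vle_anti n : antisymmetric (@vle n).
Proof.
move=> [[a b] c] [[a' b'] c'] /andP[/and3P[/= h1 h2 h3] /and3P[/= h1' h2' h3']].
by congr (_, _, _); apply/val_inj/anti_leq; apply/andP.
Qed.

Lemma vle_trans n : transitive (@vle n).
Proof.
move=> q p r /and3P[h1 h2 h3] /and3P[h1' h2' h3'].
by apply/and3P; split; [apply: leq_trans h1'|apply: leq_trans h2'|apply: leq_trans h3'].
Qed.

Definition vertices n k (z : sprod sqJ (Delta n) k) (i : 'I_k.+1) : vert n :=
  ((z.1.1 : mono k 1) i, (z.1.2 : mono k 1) i, (z.2 : mono k n) i).

Definition simplex_of n k (x : 'I_k.+1 -> vert n) : sprod sqJ (Delta n) k :=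
  ((tomono (fun i => (x i).1.1), tomono (fun i => (x i).1.2)),
   tomono (fun i => (x i).2)).

Lemma vertices_increasing n k (z : sprod sqJ (Delta n) k) :
  increasing (@vle n) (vertices z).
Proof. by move=> i j ij; apply/and3P; split; apply: mono_le. Qed.

Lemma verticesK n k (z : sprod sqJ (Delta n) k) : simplex_of (vertices z) = z.
Proof. by case: z => [[a b] c]; rewrite /simplex_of /= !tomonoK. Qed.

Lemma simplex_ofK n k (x : 'I_k.+1 -> vert n) : increasing (@vle n) x ->
  vertices (simplex_of x) = x.
Proof.
move=> xm; apply: funext => i; rewrite /vertices /= !tomonoE;
  try by move=> j j' /xm/and3P[].
by case: (x i) => [[]].
Qed.

Lemma vertices_act n m k (g : mono m k) (z : sprod sqJ (Delta n) k) :
  vertices (act g z) = fun i => vertices z (g i).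
Proof. by apply: funext => i; rewrite /vertices /= !mcompE. Qed.

Lemma simplex_of_comp n m k (g : mono m k) (x : 'I_k.+1 -> vert n) :
  increasing (@vle n) x -> simplex_of (fun i => x (g i)) = act g (simplex_of x).
Proof.
move=> xm; rewrite /simplex_of /=; congr ((_, _), _);
  by rewrite -tomono_comp // => j j' /xm/and3P[].
Qed.

Definition corner n (p : vert n) : bool := (p.1.1 == ord_max) && (p.1.2 == ord_max).

(** The image in [J x Delta n] of the join of [I] and [Delta n]: the span sits at
    level 0, and [Delta n] at the corner of the square. *)
Definition joinK n : {set {set vert n}} :=
  [set s : {set vert n} | [forall p in s, corner p || (p.2 == ord0)]]%SET.

Definition corners n : {set vert n} := [set p | corner p]%SET.

Definition joinK_boundary n : {set {set vert n}} :=
  [set s in joinK n | ~~ (corners n \subset s)]%SET.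

Lemma joinK_down n : down_closed (joinK n).
Proof.
move=> s t /fintype.subsetP st; rewrite !inE => /forall_inP h.
by apply/forall_inP => p /st; apply: h.
Qed.

Lemma joinK_boundary_down n : down_closed (joinK_boundary n).
Proof.
move=> s t st; rewrite [_ \in _]inE => /andP[tJ nt]; rewrite inE (joinK_down st) //=.
by apply: contra nt => h; apply: fintype.subset_trans st.
Qed.

Lemma joinKP n k (x : 'I_k.+1 -> vert n) : trace x \in joinK n <->
  forall i, ~~ corner (x i) -> (x i).2 = ord0.
Proof.
rewrite inE; split=> [/forall_inP h i /negPf ni|h].
  by apply/eqP; have := h _ (mem_trace x i); rewrite ni.
apply/forall_inP => _ /traceP[i ->]; case c: (corner _) => //=.
by apply/eqP/h; rewrite c.
Qed.

Lemma cornersP n k (x : 'I_k.+1 -> vert n) : ~~ (corners n \subset trace x) <->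
  exists j, forall i, corner (x i) -> (x i).2 <> j.
Proof.
split=> [/subsetPn[p]|[j xj]].
  rewrite inE => /andP[/eqP p1 /eqP p2] px; exists p.2 => i /andP[/eqP i1 /eqP i2] ip.
  case/negP: px; suff -> : p = x i by apply: mem_trace.
  by move: p1 p2 i1 i2 ip; case: p (x i) => [[a b] c] [[a' b'] c'] /= -> -> -> -> ->.
apply/subsetPn; exists (ord_max, ord_max, j); first by rewrite inE /corner /= !eqxx.
apply/traceP => -[i xi]; case: (xj i); rewrite -xi // /corner /= !eqxx //.
Qed.

(** [cone_to_sqJ_bij] only asserts that an inverse exists, so one is chosen. *)
Lemma cone_ofP : {g : forall n, sqJ n -> join spanI (Delta 0) n |
  forall n, cancel (cone_to_sqJ n) (g n) /\ cancel (g n) (cone_to_sqJ n)}.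
Proof.
have gP n : {g : sqJ n -> join spanI (Delta 0) n |
    cancel (cone_to_sqJ n) g /\ cancel g (cone_to_sqJ n)}.
  by apply: cid; case: (cone_to_sqJ_bij n) => g; exists g.
exists (fun n => sval (gP n)) => n; exact: svalP (gP n).
Qed.

Definition cone_of n (z : sqJ n) : join spanI (Delta 0) n := sval cone_ofP n z.

Lemma cone_ofK n : cancel (@cone_of n) (cone_to_sqJ n).
Proof. by case: (svalP cone_ofP n). Qed.

Lemma cone_to_sqJK n : cancel (cone_to_sqJ n) (@cone_of n).
Proof. by case: (svalP cone_ofP n). Qed.

Lemma cone_of_act m n (g : mono m n) (z : sqJ n) :
  cone_of (act g z) = act g (cone_of z).
Proof. by apply: (can_inj (@cone_to_sqJK m)); rewrite sfun_act !cone_ofK. Qed.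

Lemma cut_corner n l (y : join spanI (Delta 0) l) (d : mono l n) i :
  (cut y i == ord_max) = corner (vertices ((cone_to_sqJ l y, d) : sprod sqJ (Delta n) l) i).
Proof.
rewrite /corner /vertices [X in (X == _) && _]cone_to_sqJ1 [X in _ && (X == _)]cone_to_sqJ2.
have [e|ne] := pselect (cut y i = ord0); last first.
  by rewrite !cone_coord_back // !eqxx; case: (ord2P (cut y i)) => // ->.
have h : fiber (cut y) ord0 0 (mconst 0 i) by rewrite /= mcomp_constr e.
rewrite e -[i](mconstE i (ord0 : 'I_1)) !(cone_coord_front _ h).
apply/esym/andP => -[/eqP h1 /eqP h2].
by case: (front y 0 _) h1 h2 => v vI /= h1 h2; apply: (vI ord0).
Qed.

Definition to_point n : smap (join spanI (Delta n)) (join spanI (Delta 0)) :=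
  join_mapr spanI (Delta_map (mconst n ord0)).

Lemma to_point_id l (y : join spanI (Delta 0) l) : to_point 0 l y = y.
Proof.
apply: join_eq => [|k f hx hy|k f hx hy] //=; last by rewrite [LHS]mono0E [RHS]mono0E.
by congr (front y k _); apply: sig_eq.
Qed.

Lemma to_point_mapr m n (d : mono m n) l (y : join spanI (Delta m) l) :
  to_point n l (join_mapr spanI (Delta_map d) l y) = to_point m l y.
Proof. by rewrite /to_point -join_mapr_comp mcomp_const. Qed.

(** An embedding of the join of [I] and [Delta n] with image [joinK], of which
    [prod_to_join] below is a retraction. *)
Definition join_to_prod n : smap (join spanI (Delta n)) (sprod sqJ (Delta n)).
Proof.
refine (@SMap (join spanI (Delta n)) (sprod sqJ (Delta n))
  (fun l y => (cone_to_sqJ l (to_point n l y), mlevel y)) _).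
move=> m l g y; rewrite (sfun_act (to_point n)) sfun_act.
apply: injective_projections => //.
by apply: mono_eq => i; rewrite mcompE !mkmonoE level_act.
Defined.

Definition prod_to_join n l (z : sprod sqJ (Delta n) l) : join spanI (Delta n) l :=
  join_mapr spanI (Delta_map z.2) l (taut_join (front (cone_of z.1))).

Lemma prod_to_join_act n m l (g : mono m l) (z : sprod sqJ (Delta n) l) :
  prod_to_join (act g z) = act g (prod_to_join z).
Proof.
rewrite /prod_to_join -(sfun_act (join_mapr _ _)) taut_join_act -join_mapr_comp /=.
by rewrite cone_of_act.
Qed.

Lemma corner_join_to_prod n l (y : join spanI (Delta n) l) i :
  corner (vertices (join_to_prod n l y) i) = (cut y i == ord_max).
Proof. by rewrite -cut_corner. Qed.

Lemma join_to_prod_joinK n l (y : join spanI (Delta n) l) :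
  trace (vertices (join_to_prod n l y)) \in joinK n.
Proof.
apply/joinKP => i; rewrite corner_join_to_prod => /eqP ne.
by rewrite [LHS]mkmonoE level_front.
Qed.

Lemma prod_to_joinK n l (z : sprod sqJ (Delta n) l) :
  trace (vertices z) \in joinK n -> join_to_prod n l (prod_to_join z) = z.
Proof.
move=> /joinKP zJ; rewrite [RHS]surjective_pairing; congr (_, _).
  rewrite -[RHS]cone_ofK /prod_to_join to_point_mapr; congr (cone_to_sqJ l _).
  apply: join_eq => [|k f hx hy|k f hx hy] //=; last by rewrite [LHS]mono0E [RHS]mono0E.
  by congr (front (cone_of z.1) k _); apply: sig_eq.
apply: mono_eq => i; rewrite mkmonoE level_mapr level_taut /=.
have zi : corner (vertices z i) = (cut (cone_of z.1) i == ord_max).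
  rewrite (cut_corner _ z.2) cone_ofK; congr (corner (vertices _ i)).
  exact: surjective_pairing.
have := zJ i : ~~ _ -> (z.2 : mono l n) i = ord0.
by rewrite -zi; case: (corner _) => // ->.
Qed.

Section Extension.
Variables (C : sSet) (s : smap sqJ C).

Definition based n (f : pmap (vert n) C) : Prop := forall k (z : sqJ k),
  f k (vertices ((z, mconst k ord0) : sprod sqJ (Delta n) k)) = s k z.

Lemma join_inl_based n (f : pmap (vert n) C) l (y : spanI l) : based f ->
  f l (vertices (join_to_prod n l (join_inl spanI (Delta n) l y))) =
  scomp s inclI l y.
Proof.
move=> fs; have -> : join_to_prod n l (join_inl spanI (Delta n) l y) =
    (inclI l y, mconst l ord0) :> sprod sqJ (Delta n) l.
  congr (_, _); last first.
    apply: mono_eq => i; rewrite mkmonoE mconstE level_front //=.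
    by rewrite mconstE.
  rewrite -cone_to_sqJ_inl; congr (cone_to_sqJ l _).
  exact: (congr1 (fun u : smap spanI _ => u l y) (join_mapr_inl _ _)).
exact: fs.
Qed.

(** At the corner the simplex misses some level [j]. If [j] is not 0, then its
    levels already form a simplex of the boundary, as the vertices off the corner
    are at level 0; otherwise the level 0 is replaced by 1 throughout, which does
    not affect the vertices at the corner. *)
Lemma joinK_boundary_lift n k (x : 'I_k.+1 -> vert n.+1) :
  in_family (@vle n.+1) (joinK_boundary n.+1) x ->
  exists d : sub (boundary n.+1) k,
    forall i, corner (x i) -> (sval d : mono k n.+1) i = (x i).2.
Proof.
move=> [xm]; rewrite inE => /andP[/joinKP xJ /cornersP[j xj]].
have [j0|j0] := eqVneq j ord0; last first.
  have m2 : forall i i' : 'I_k.+1, i <= i' -> (x i).2 <= (x i').2.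
    by move=> i i' /xm/and3P[].
  have db : boundary n.+1 k (mkmono m2).
    exists j => i; rewrite mkmonoE; case c: (corner (x i)); first exact: xj.
    by rewrite xJ ?c // => /esym/eqP; apply/negP.
  by exists (exist _ _ db) => i _ /=; rewrite mkmonoE.
pose one : 'I_n.+2 := lift ord0 ord0.
pose u i := if (x i).2 == ord0 then one else (x i).2.
have um (i i' : 'I_k.+1) : i <= i' -> u i <= u i'.
  move=> /xm/and3P[_ _]; rewrite /u.
  have [e|ne] := eqVneq (x i).2 ord0; have [e'|ne'] := eqVneq (x i').2 ord0 => //.
    by move=> _; rewrite lt0n.
  by rewrite e' leqn0 => /eqP e0; case/eqP: ne; apply: val_inj.
have db : boundary n.+1 k (mkmono um).
  exists j => i; rewrite (mkmonoE um) j0 /u.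
  by have [_ /(congr1 val)|/eqP] := eqVneq (x i).2 ord0.
exists (exist _ _ db) => i ci /=; rewrite (mkmonoE um) /u.
have [e|//] := eqVneq (x i).2 ord0.
by case: (xj i ci); rewrite e j0.
Qed.

(** The cocone, parametrized by the simplex [d] of [Delta n], that a partial map
    on [J x Delta n] determines. *)
Definition restrict n (f : pmap (vert n) C) k (d : mono k n) l (y : join spanI (Delta k) l) :=
  f l (vertices (join_to_prod n l (join_mapr spanI (Delta_map d) l y))).

Lemma restrict_boundary n k (d : mono k n) l (y : join spanI (Delta k) l) :
  boundary n k d -> in_family (@vle n) (joinK_boundary n)
    (vertices (join_to_prod n l (join_mapr spanI (Delta_map d) l y))).
Proof.
move=> [j dj]; split; first exact: vertices_increasing.
rewrite inE join_to_prod_joinK andTb; apply/cornersP; exists j => i.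
rewrite corner_join_to_prod => cy.
rewrite [X in X <> _]mkmonoE level_mapr ifT //; exact: dj.
Qed.

Lemma restrict_slice n (f : pmap (vert n) C) K :
  based f -> natural_on (@vle n) K f ->
  forall k (d : mono k n),
  (forall l (y : join spanI (Delta k) l), in_family (@vle n) K
    (vertices (join_to_prod n l (join_mapr spanI (Delta_map d) l y)))) ->
  {q : slice (scomp s inclI) k | forall l y, sval q l y = restrict f d y}.
Proof.
move=> fs fK k d dK.
have nat m l (g : mono m l) y : restrict f d (act g y) = act g (restrict f d y).
  by rewrite /restrict -fK // !sfun_act vertices_act.
have base : scomp (SMap (@restrict n f k d) nat) (join_inl spanI (Delta k)) =
    scomp s inclI.
  apply: smap_eq => l y; rewrite -(join_inl_based _ fs).
  congr (f l (vertices (join_to_prod n l _))).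
  exact: (congr1 (fun u : smap spanI _ => u l y) (join_mapr_inl _ _)).
by exists (exist _ (SMap (@restrict n f k d) nat) base).
Qed.

(** The partial map amounts to a sphere in the slice under the span, with the
    cocone [s] as its vertex 0, and a filler of that sphere is evaluated along
    the retraction [prod_to_join]. *)
Lemma pushout_extends n (f : pmap (vert n.+1) C) : is_pushout s ->
  natural_on (@vle _) (joinK_boundary n.+1) f -> based f ->
  exists f', natural_on (@vle _) (joinK n.+1) f' /\
    agree (@vle _) (joinK_boundary n.+1) f' f.
Proof.
move=> sP fK fs.
pose bq k (d : sub (boundary n.+1) k) := restrict_slice fs fK
  (fun l y => restrict_boundary y (svalP d)).
have bact m k (g : mono m k) d : sval (bq m (act g d)) = act g (sval (bq k d)).
  apply: sig_eq; apply: smap_eq => l y; rewrite (svalP (bq m (act g d))) /=.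
  by rewrite (svalP (bq k d)) /restrict join_mapr_comp.
pose b := @SMap (sub (boundary n.+1)) (slice (scomp s inclI))
  (fun k d => sval (bq k d)) bact.
have [|t tb] := sP n b.
  apply: sig_eq; apply: smap_eq => l y; rewrite (svalP (bq 0 _)) /restrict.
  rewrite [RHS](_ : _ = s l (cone_to_sqJ l y)) // -fs; congr (f l (vertices _)).
  apply: injective_projections.
    by congr (cone_to_sqJ l _); rewrite to_point_mapr to_point_id.
  apply: mono_eq => i; rewrite mkmonoE level_mapr !mconstE.
  by case: ifP.
pose q := t n.+1 (mid n.+1).
exists (fun k x => sval q k (prod_to_join (simplex_of x))); split.
  move=> m k g x [xm _].
  by rewrite simplex_of_comp // prod_to_join_act sfun_act.
move=> k x xB; have [d dE] := joinK_boundary_lift xB; case: (xB) => xm xJ.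
rewrite /prod_to_join.
rewrite (@taut_join_congr _ _ _ _ (sval d)); last first.
  move=> i; move/eqP; rewrite (cut_corner _ (simplex_of x).2) cone_ofK.
  rewrite -surjective_pairing simplex_ofK // => /dE ->.
  by rewrite tomonoE // => j j' /xm/and3P[].
have qd : act (sval d) q = b k d.
  rewrite -tb /q -sfun_act /=; congr (t k _).
  by apply: mono_eq => i; rewrite mcompE midE.
transitivity (sval (act (sval d) q) k (taut_join (front (cone_of (simplex_of x).1)))).
  by [].
rewrite qd (svalP (bq k d)) /restrict.
rewrite -(@taut_join_congr _ _ _ (simplex_of x).2); last first.
  move=> i; move/eqP; rewrite (cut_corner _ (simplex_of x).2) cone_ofK.
  rewrite -surjective_pairing simplex_ofK // => /dE ->.
  by rewrite tomonoE // => j j' /xm/and3P[].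
rewrite prod_to_joinK simplex_ofK //; move: xJ; rewrite inE; by case/andP.
Qed.

Lemma level0_in_boundary n k (z : sqJ k) :
  in_family (@vle _) (joinK_boundary n.+1)
    (vertices ((z, mconst k ord0) : sprod sqJ (Delta n.+1) k)).
Proof.
split; first exact: vertices_increasing.
rewrite inE; apply/andP; split; first by apply/joinKP => i _; apply: mconstE.
by apply/cornersP; exists ord_max => i _; rewrite /vertices /= mconstE.
Qed.

(** Every sphere in the slice arises from a partial map. A simplex of the join
    with the boundary has no preferred simplex of the boundary attached to it, only
    one on the final part of its cut; by [slice_taut_congr] any extension of the
    latter to all vertices gives the same value. *)
Lemma extends_pushout :
  (forall n (f : pmap (vert n.+1) C),
    natural_on (@vle _) (joinK_boundary n.+1) f -> based f ->
    exists f', natural_on (@vle _) (joinK n.+1) f' /\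
      agree (@vle _) (joinK_boundary n.+1) f' f) ->
  is_pushout s.
Proof.
move=> ext n b b0.
pose w k (x : 'I_k.+1 -> vert n.+1) := cone_of (simplex_of x).1.
have w_cut k (x : 'I_k.+1 -> vert n.+1) i : increasing (@vle _) x ->
    (cut (w k x) i == ord_max) = corner (x i).
  move=> xm; rewrite (cut_corner _ (simplex_of x).2) cone_ofK.
  by rewrite -surjective_pairing simplex_ofK.
pose f : pmap (vert n.+1) C := fun k x =>
  if pselect (in_family (@vle _) (joinK_boundary n.+1) x) is left h
  then sval (b k (sval (cid (joinK_boundary_lift h)))) k (taut_join (front (w k x)))
  else s k (mconst k ord0, mconst k ord0).
have fE k (x : 'I_k.+1 -> vert n.+1) (d : sub (boundary n.+1) k) :
    in_family (@vle _) (joinK_boundary n.+1) x ->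
    (forall i, corner (x i) -> (sval d : mono k n.+1) i = (x i).2) ->
    f k x = sval (b k d) k (taut_join (front (w k x))).
  move=> xB dE; rewrite /f; case: pselect => // h; case: (cid _) => d' d'E /=.
  apply: slice_taut_congr => i /eqP; rewrite w_cut; last by case: xB.
  by move=> ci; rewrite dE // d'E.
have fB : natural_on (@vle _) (joinK_boundary n.+1) f.
  move=> m k g x xB; have [d dE] := joinK_boundary_lift xB.
  rewrite (fE _ _ d) // -(sfun_act (sval (b k d))) taut_join_act.
  rewrite (fE _ _ (act g d)); last 2 first.
  - exact: in_family_comp (@joinK_boundary_down n.+1) xB.
  - by move=> i ci; rewrite [LHS]mcompE dE.
  rewrite sfun_act; case: (xB) => xm _.
  by rewrite /w simplex_of_comp // cone_of_act.
have fs : based f.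
  move=> k z.
  have c0b : boundary n.+1 k (mconst k ord0).
    by exists ord_max => i; rewrite mconstE.
  rewrite (fE _ _ (exist _ _ c0b)) //; last exact: level0_in_boundary.
  have -> : exist _ _ c0b = act (mconst k ord0)
      (exist _ (mconst 0 ord0) (boundary_vertex ord0) : sub (boundary n.+1) 0).
    by apply: sig_eq; rewrite /= mcomp_const.
  rewrite sfun_act b0 /w verticesK.
  rewrite [LHS](_ : _ = s k (cone_to_sqJ k (to_point k k
    (taut_join (front (cone_of z)))))) //.
  rewrite -[z in RHS]cone_ofK; congr (s k (cone_to_sqJ k _)).
  apply: join_eq => [|j h hx hy|j h hx hy] //; last by rewrite [LHS]mono0E [RHS]mono0E.
  by congr (front (cone_of z) j _); apply: sig_eq.
have [f' [f'J f'f]] := ext n f fB fs.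
have f's : based f'.
  by move=> k z; rewrite f'f ?fs //; apply: level0_in_boundary.
pose tq k (d : mono k n.+1) := restrict_slice f's f'J (fun l y => conj
  (vertices_increasing (join_to_prod n.+1 l (join_mapr spanI (Delta_map d) l y)))
  (join_to_prod_joinK _)).
have tact m k (g : mono m k) (d : Delta n.+1 k) :
    sval (tq m (act g d)) = act g (sval (tq k d)).
  apply: sig_eq; apply: smap_eq => l y; rewrite (svalP (tq m (act g d))) /=.
  by rewrite (svalP (tq k d)) /restrict join_mapr_comp.
exists (@SMap (Delta n.+1) (slice (scomp s inclI)) (fun k d => sval (tq k d)) tact).
apply: smap_eq => k d; apply: sig_eq; apply: smap_eq => l y.
rewrite (svalP (tq k (sval d))) /restrict.
have yB := restrict_boundary y (svalP d).
rewrite f'f //; have [yi _] := yB.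
rewrite (fE _ _ (act (mlevel y) d)) //; last first.
  move=> i; rewrite corner_join_to_prod => cy.
  by rewrite [RHS]mkmonoE level_mapr ifT // [LHS]mcompE mkmonoE.
have wE : cone_of (join_to_prod n.+1 l (join_mapr spanI (Delta_map (sval d)) l y)).1 =
    to_point k l y.
  by rewrite -[RHS]cone_to_sqJK -(to_point_mapr (sval d)).
rewrite /w verticesK wE sfun_act.
by rewrite -[y in RHS]join_taut.
Qed.

End Extension.

(** [SpecialHorn.special_horn_fills] for a chain whose two lowest vertices are [v]
    and [q]. *)
Lemma degenerate_horn_fills (P : finType) (le : rel P) (C : sSet) (f : pmap P C)
    (s : {set P}) (v q : P) :
  quasicategory C -> v \in s -> q \in s -> q != v -> 2 < #|s| ->
  (forall p, p \in s -> le v p) ->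
  (forall p, p \in s -> p != v -> le q p) ->
  (forall k (x x' : 'I_k.+1 -> P), increasing le x -> increasing le x' ->
    (forall i, x i \in [set v; q]%SET) -> (forall i, x' i \in [set v; q]%SET) ->
    f k x = f k x') ->
  horn_fills le f s v.
Proof.
move=> qcatC vs qs qv s2 v_min q_min f_edge d e k ds [es ele] ek.
case: d e k ds es ele ek => [|[|N]] e k ds es ele ek; try by rewrite -ds in s2.
have e_in i : e i \in s by rewrite -es mem_trace.
have k0 : k = ord0.
  apply/val_inj/eqP; rewrite -leqn0 -[X in _ <= X]/(val (ord0 : 'I_N.+3)).
  by rewrite -ele ek v_min.
rewrite k0 => h hE; apply: SpecialHorn.special_horn_fills => // l u u' lu lu'.
have low (w : sub (horn (ord0 : 'I_N.+3)) l) :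
    (forall i, (sval w : mono l N.+2) i <= 1) ->
    increasing le (fun i => e ((sval w : mono l N.+2) i)) /\
    (forall i, e ((sval w : mono l N.+2) i) \in [set v; q]%SET).
  move=> wl; split=> [i j /(mono_le (sval w : mono l N.+2))|i]; first by rewrite ele.
  rewrite !inE -ek k0; have := wl i; rewrite leq_eqVlt ltnS leqn0 => /orP[/eqP w1|w0].
    apply/orP; right; move: qs; rewrite -es => /traceP[j qj].
    have je : j <= (sval w : mono l N.+2) i.
      rewrite -ele -qj q_min // -ek k0; apply/eqP => we.
      by have := ele ((sval w : mono l N.+2) i) ord0; rewrite we ele w1.
    apply/eqP; rewrite qj; congr e; apply/val_inj/eqP; rewrite /= eqn_leq je andbT w1.
    rewrite lt0n; apply: contraNneq qv => j0; rewrite qj -ek k0.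
    by apply/eqP; congr e; apply: val_inj.
  by apply/orP; left; apply/eqP; congr e; apply/val_inj/eqP.
by have [wm ws] := low _ lu; have [wm' ws'] := low _ lu'; rewrite !hE; apply: f_edge.
Qed.

(** * Identity squares are pushouts *)

Section DegenerateSquare.
Variables (C : sSet) (s : smap sqJ C) (h : bool).
Hypothesis qcatC : quasicategory C.

(** The two middle vertices of the square. The boolean exchanges them, so that one
    argument covers both kinds of identity squares. *)
Definition side (h : bool) : 'I_2 * 'I_2 :=
  if h then (ord_max, ord0) else (ord0, ord_max).

Definition sq_vertex k (z : sqJ k) (i : 'I_k.+1) : 'I_2 * 'I_2 :=
  ((z.1 : mono k 1) i, (z.2 : mono k 1) i).

(** Degeneracy of the image of the edge, in a form that needs no coordinate along
    the edge. *)
Definition degenerate_edge (p q : 'I_2 * 'I_2) : Prop :=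
  forall k (z z' : sqJ k),
  (forall i, sq_vertex z i \in [set p; q]%SET) ->
  (forall i, sq_vertex z' i \in [set p; q]%SET) -> s k z = s k z'.

Hypothesis edge_to_corner : degenerate_edge (side h) (ord_max, ord_max).
Hypothesis edge_from_origin : degenerate_edge (ord0, ord0) (side (~~ h)).

Section Level.
Variable n : nat.

Definition at0 (p : 'I_2 * 'I_2) : vert n.+1 := (p, ord0).
Notation o := (at0 (ord0, ord0)).
Notation a := (at0 (side h)).
Notation b := (at0 (side (~~ h))).
Notation c := (at0 (ord_max, ord_max)).
Notation le := (@vle n.+1).

Lemma based_edge (f : pmap (vert n.+1) C) p q : based s f -> degenerate_edge p q ->
  forall k (x x' : 'I_k.+1 -> vert n.+1), increasing le x -> increasing le x' ->
    (forall i, x i \in [set at0 p; at0 q]%SET) ->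
    (forall i, x' i \in [set at0 p; at0 q]%SET) -> f k x = f k x'.
Proof.
move=> fs pq.
have fE k (x : 'I_k.+1 -> vert n.+1) : increasing le x ->
    (forall i, x i \in [set at0 p; at0 q]%SET) ->
    f k x = s k (simplex_of x).1 /\
    forall i, sq_vertex (simplex_of x).1 i \in [set p; q]%SET.
  move=> xm xpq; split.
    rewrite -fs; congr (f k _); apply: funext => i.
    rewrite -[in LHS](simplex_ofK xm) /vertices; congr (_, _).
    rewrite mconstE /= tomonoE; last by move=> j j' /xm/and3P[].
    by have := xpq i; rewrite !inE => /orP[] /eqP ->.
  move=> i; rewrite /sq_vertex /= !tomonoE; try by move=> j j' /xm/and3P[].
  rewrite -surjective_pairing; have := xpq i.
  by rewrite !inE => /orP[] /eqP -> /=; rewrite eqxx ?orbT.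
move=> k x x' xm xm' xpq xpq'.
have [-> xv] := fE _ _ xm xpq; have [-> xv'] := fE _ _ xm' xpq'.
exact: pq.
Qed.

Lemma corners_family (A : {set vert n.+1}) :
  (forall p, p \in A -> p.2 = ord0) -> A :|: corners n.+1 \in joinK n.+1.
Proof.
move=> A0; rewrite inE; apply/forall_inP => p; rewrite inE => /orP[/A0 ->|].
  by rewrite eqxx orbT.
by rewrite inE => ->.
Qed.

Lemma corners_face (A : {set vert n.+1}) w : (forall p, p \in A -> p.2 = ord0) ->
  corner w -> (A :|: corners n.+1) :\ w \in joinK_boundary n.+1.
Proof.
move=> A0 cw; rewrite inE; apply/andP; split.
  exact: joinK_down (finset.subsetDl _ _) (corners_family A0).
by apply/subsetPn; exists w; rewrite !inE ?eqxx.
Qed.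

Lemma corners_notin (A : {set vert n.+1}) : A :|: corners n.+1 \notin joinK_boundary n.+1.
Proof. by rewrite inE negb_and negbK finset.subsetUr orbT. Qed.

Lemma corner_side (h' : bool) : corner (at0 (side h')) = false.
Proof. by case: h'. Qed.

Lemma corners_rem (A : {set vert n.+1}) p : corner p = false -> p \in A ->
  (A :|: corners n.+1) :\ p = (A :\ p) :|: corners n.+1.
Proof.
move=> cp pA; apply/setP => q; rewrite !inE.
by have [->|] := eqVneq q p; rewrite //= cp.
Qed.

Lemma in_corners (A : {set vert n.+1}) p : corner p = false ->
  (p \in A :|: corners n.+1) = (p \in A).
Proof. by move=> cp; rewrite !inE cp orbF. Qed.

(** Let [D] be the set of all corners. The outer horn of [a, D] at [a] supplies
    [D], the inner horn of [o, a, D] at [a] supplies [o, D], and the outer horn of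
    [o, b, D] at [o] supplies [b, D]. The first edges of the outer horns, from [a]
    to the corner at level 0 and from [o] to [b], are degenerate. *)
Lemma degenerate_extends (f : pmap (vert n.+1) C) :
  natural_on le (joinK_boundary n.+1) f -> based s f ->
  exists f', natural_on le (joinK n.+1) f' /\
    agree le (joinK_boundary n.+1) f' f.
Proof.
move=> fB fs; pose full (A : {set vert n.+1}) := A :|: corners n.+1.
have ca : corner a = false := corner_side h.
have cb : corner b = false := corner_side (~~ h).
have co : corner o = false by [].
have cc : corner c by [].
have [oa ob ab] : [/\ o != a, o != b & a != b] by case: (h).
have [ac oc] : a != c /\ o != c by case: (h).
have chain_full (A : {set vert n.+1}) :
    {in A &, total le} -> (forall p, p \in A -> p.2 = ord0) ->
    chain le (full A).
  move=> At A0; have low p q : p \in A -> corner q -> le p q.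
    move=> /A0 p0 /andP[/eqP q1 /eqP q2].
    by rewrite /vle p0 q1 q2 leq0n !leq_ord.
  apply/chainP => p q; rewrite !inE => /orP[pA|cp] /orP[qA|cq].
  - exact: At.
  - by rewrite low.
  - by rewrite (low q p) ?orbT.
  - case/andP: cp cq => /eqP p1 /eqP p2 /andP[/eqP q1 /eqP q2].
    by rewrite /vle p1 p2 q1 q2 !leqnn /= leq_total.
have face (A : {set vert n.+1}) w : (forall p, p \in A -> p.2 = ord0) -> corner w ->
    full A :\ w \in joinK_boundary n.+1 by apply: corners_face.
have notB (A : {set vert n.+1}) : full A \notin joinK_boundary n.+1 by apply: corners_notin.
have full_ne (A A' : {set vert n.+1}) p :
    corner p = false -> p \in A -> p \notin A' -> full A != full A'.
  move=> cp pA; apply: contraNneq => AA'.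
  by rewrite -(in_corners A' cp) -/(full A') -AA' (in_corners A cp).
have card_full (A : {set vert n.+1}) p : corner p = false -> p \in A -> 2 < #|full A|.
  move=> cp pA; apply/card_gt2P; exists p, c, (ord_max, ord_max, ord_max).
  split; split; rewrite ?inE ?pA ?orbT //.
    by apply: contraFneq cp => ->.
  by apply: contraFneq cp => <-.
have up (A : {set vert n.+1}) p :
    {in A &, total le} -> (forall p, p \in A -> p.2 = ord0) -> p \in A ->
    (forall q, q \in A -> le p q) -> forall q, q \in full A -> le p q.
  move=> At A0 pA pmin q; rewrite !inE => /orP[/pmin //|/andP[/eqP q1 /eqP q2]].
  by rewrite /vle (A0 _ pA) q1 q2 leq0n !leq_ord.
have c_min (A : {set vert n.+1}) q : q \in full A -> q \notin A -> le c q.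
  rewrite !inE => /orP[-> //|/andP[/eqP q1 /eqP q2] _].
  by rewrite /vle q1 q2 !leqnn leq0n.
have c_full (A : {set vert n.+1}) : c \in full A by rewrite !inE cc orbT.
pose A1 : {set vert n.+1} := [set a]%SET.
pose A2 : {set vert n.+1} := [set o; a]%SET.
pose A3 : {set vert n.+1} := [set o; b]%SET.
have A10 p : p \in A1 -> p.2 = ord0 by rewrite inE => /eqP ->.
have A20 p : p \in A2 -> p.2 = ord0 by rewrite !inE => /orP[] /eqP ->.
have A30 p : p \in A3 -> p.2 = ord0 by rewrite !inE => /orP[] /eqP ->.
have le_o p : le o p by rewrite /vle !leq0n.
have A1t : {in A1 &, total le}.
  by move=> p q; rewrite !inE => /eqP -> /eqP ->; rewrite vle_refl.
have A2t : {in A2 &, total le}.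
  by move=> p q; rewrite !inE => /orP[] /eqP -> /orP[] /eqP ->; rewrite ?le_o ?vle_refl ?orbT.
have A3t : {in A3 &, total le}.
  by move=> p q; rewrite !inE => /orP[] /eqP -> /orP[] /eqP ->; rewrite ?le_o ?vle_refl ?orbT.
have rem (A : {set vert n.+1}) p :
    corner p = false -> p \in A -> full A :\ p = full (A :\ p).
  exact: corners_rem.
have a1 : a \in full A1 by rewrite !inE eqxx.
have r1 : full A1 :\ a = full finset.set0.
  by rewrite rem ?inE //; congr full; apply/setP => p; rewrite !inE andNb.
have f1 w : w \in full A1 -> w != a -> full A1 :\ w \in joinK_boundary n.+1.
  by move=> wf wa; apply: face => //; move: wf; rewrite !inE (negPf wa).
(* The outer horn at [a]. *)
have [g1 [g1K g1f]] : exists g1,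
    natural_on le (joinK_boundary n.+1 :|: [set full A1; full A1 :\ a]) g1 /\
    agree le (joinK_boundary n.+1) g1 f.
  apply: (attach (@vle_refl _) (@vle_anti _) (@vle_trans _) (@joinK_boundary_down _) fB
    (chain_full A1 A1t A10) a1 f1); first by rewrite r1.
  apply: (degenerate_horn_fills (q := c)) => //.
  - by rewrite eq_sym.
  - by apply: (card_full _ a) => //; rewrite inE.
  - by apply: up => //; [rewrite inE|move=> q; rewrite inE => /eqP ->; rewrite vle_refl].
  - by move=> p pf pa; apply: c_min pf _; rewrite inE.
  - exact: based_edge fs edge_to_corner.
have K1d := down_closed_attach (@joinK_boundary_down _) f1.
have o2 : o \in full A2 by rewrite !inE eqxx.
have a2 : a \in full A2 by rewrite !inE eqxx orbT.
have r2o : full A2 :\ o = full A1.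
  rewrite rem ?inE ?eqxx //; congr full; apply/setP => p; rewrite !inE.
  by have [->|] := eqVneq p o; rewrite // (negPf oa).
have r2 : full A2 :\ a = full [set o]%SET.
  rewrite rem ?inE ?eqxx ?orbT //; congr full; apply/setP => p; rewrite !inE.
  by have [->|] := eqVneq p a; rewrite ?orbF // eq_sym (negPf oa).
have f2 w : w \in full A2 -> w != a ->
    full A2 :\ w \in joinK_boundary n.+1 :|: [set full A1; full A1 :\ a].
  move=> wf wa; have [->|wo] := eqVneq w o.
    by apply/setUP; right; rewrite r2o; apply/set2P; left.
  apply/setUP; left; apply: face => //; move: wf.
  by rewrite !inE (negPf wa) (negPf wo).
have n2 : full A2 :\ a \notin joinK_boundary n.+1 :|: [set full A1; full A1 :\ a].
  rewrite r2 r1 !finset.in_setU !finset.in_set1 !negb_or notB /=.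
  by apply/andP; split; apply: (full_ne _ _ o); rewrite ?inE.
have ca' : c != a by rewrite eq_sym.
have lac : le a c.
  apply: up A1t A10 _ _ _ _ => //; rewrite ?inE // => q.
  by rewrite inE => /eqP ->; rewrite vle_refl.
(* The inner horn at [a]. *)
have [g2 [g2K g2g1]] := attach (@vle_refl _) (@vle_anti _) (@vle_trans _) K1d g1K
  (chain_full A2 A2t A20) a2 f2 n2
  (inner_horn_fills qcatC o2 oa (le_o a) (c_full A2) ca' lac).
have K2d := down_closed_attach K1d f2.
have g2f : agree le (joinK_boundary n.+1) g2 f.
  by apply: agree_trans g1f; apply: agreeS g2g1; apply: finset.subsetUl.
have g2s : based s g2.
  by move=> k z; rewrite g2f ?fs //; apply: level0_in_boundary.
have o3 : o \in full A3 by rewrite !inE eqxx.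
have r3 : full A3 :\ o = full [set b]%SET.
  rewrite rem ?inE ?eqxx //; congr full; apply/setP => p; rewrite !inE.
  by have [->|] := eqVneq p o; rewrite // (negPf ob).
have r3b : full A3 :\ b = full [set o]%SET.
  rewrite rem ?inE ?eqxx ?orbT //; congr full; apply/setP => p; rewrite !inE.
  by have [->|] := eqVneq p b; rewrite ?orbF // eq_sym (negPf ob).
set K2 := joinK_boundary n.+1 :|: _ :|: _ in g2K K2d.
have f3 w : w \in full A3 -> w != o -> full A3 :\ w \in K2.
  move=> wf wo; have [->|wb] := eqVneq w b.
    by apply/setUP; right; rewrite r3b r2; apply/set2P; right.
  apply/setUP; left; apply/setUP; left; apply: face => //; move: wf.
  by rewrite !inE (negPf wb) (negPf wo).
have n3 : full A3 :\ o \notin K2.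
  rewrite r3 /K2 r2 r1 !finset.in_setU !finset.in_set1 !negb_or notB /=.
  have ba : b != a by rewrite eq_sym.
  have bo : b != o by rewrite eq_sym.
  by do ?[apply/andP; split]; apply: (full_ne _ _ b); rewrite ?inE ?eqxx //;
    rewrite negb_or ?ba ?bo.
(* The outer horn at [o]. *)
have [g3 [g3K g3g2]] : exists g3,
    natural_on le (K2 :|: [set full A3; full A3 :\ o]) g3 /\ agree le K2 g3 g2.
  apply: (attach (@vle_refl _) (@vle_anti _) (@vle_trans _) K2d g2K
    (chain_full A3 A3t A30) o3 f3 n3).
  apply: (degenerate_horn_fills (q := b)) => //.
  - by rewrite !inE eqxx orbT.
  - by rewrite eq_sym.
  - by apply: (card_full _ o) => //; rewrite !inE eqxx.
  - move=> p pf po; have [->|pb] := eqVneq p b; first exact: vle_refl.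
    have cp : corner p by move: pf; rewrite !inE (negPf po) (negPf pb).
    case/andP: cp => /eqP p1 /eqP p2; by rewrite /vle p1 p2 !leq_ord leq0n.
  - exact: based_edge g2s edge_from_origin.
(* A chain of the join that contains all corners is determined by its trace on
   the span, which is one of six chains. *)
exists g3; split; last first.
  by apply: agree_trans g2f; apply: agreeS g3g2; rewrite /K2 -finset.setUA finset.subsetUl.
move=> m k g x [xm xJ]; apply: g3K; split=> //.
set t := trace x in xJ *; have tc : chain le t by apply: chain_trace.
have [tfull|tB] := boolP (corners n.+1 \subset t); last first.
  by apply/setUP; left; apply/setUP; left; apply/setUP; left; rewrite inE xJ.
have tE (A : {set vert n.+1}) : A \subset [set o; a; b]%SET ->
    (o \in t) = (o \in A) -> (a \in t) = (a \in A) -> (b \in t) = (b \in A) ->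
    t = full A.
  move=> /fintype.subsetP As to ta tb; apply/setP => p; rewrite finset.in_setU.
  case cp: (corner p); first by rewrite (fintype.subsetP tfull) inE cp ?orbT.
  rewrite inE cp orbF; have [pabc|npabc] := boolP (p \in [set o; a; b]%SET).
    by move: pabc; rewrite !inE => /orP[/orP[]|] /eqP ->.
  apply/idP/idP => [pt|/As]; last by rewrite (negPf npabc).
  case/negP: npabc; move: xJ; rewrite inE => /forall_inP/(_ _ pt); rewrite cp /=.
  case: p cp {pt} => [[p1 p2] l] /= cp /eqP ->; rewrite !inE.
  by move: cp; case: (ord2P p1) (ord2P p2) (h) => -> [] -> [].
(* The vertices [a] and [b] are incomparable. *)
have nab : ~~ ((a \in t) && (b \in t)).
  by apply/andP => -[ta tb]; have := chainP _ _ tc _ _ ta tb; case: (h).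
have [ao ba bo] : [/\ a != o, b != a & b != o] by split; rewrite eq_sym.
have sub_oab (A : {set vert n.+1}) : (forall p, p \in A -> [|| p == o, p == a | p == b]) ->
    A \subset [set o; a; b]%SET.
  by move=> As; apply/fintype.subsetP => p /As; rewrite !inE orbA.
have mems := (eqxx, negPf oa, negPf ob, negPf ab, negPf ao, negPf ba, negPf bo, orbT, orbF).
case ta: (a \in t) nab tE; case tb: (b \in t) => //= _ tE;
  case to: (o \in t) tE => tE.
- have -> : t = full A2.
    apply: tE; rewrite ?inE ?mems //; apply: sub_oab => p.
    by rewrite !inE => /orP[] ->; rewrite ?orbT.
  by apply/setUP; left; apply/setUP; right; apply/set2P; left.
- have -> : t = full A1.
    apply: tE; rewrite ?inE ?mems //; apply: sub_oab => p.
    by rewrite !inE => ->; rewrite ?orbT.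
  by apply/setUP; left; apply/setUP; left; apply/setUP; right; apply/set2P; left.
- have -> : t = full A3.
    apply: tE; rewrite ?inE ?mems //; apply: sub_oab => p.
    by rewrite !inE => /orP[] ->; rewrite ?orbT.
  by apply/setUP; right; apply/set2P; left.
- have -> : t = full [set b]%SET.
    apply: tE; rewrite ?inE ?mems //; apply: sub_oab => p.
    by rewrite !inE => ->; rewrite ?orbT.
  by apply/setUP; right; apply/set2P; right.
- have -> : t = full [set o]%SET.
    apply: tE; rewrite ?inE ?mems //; apply: sub_oab => p.
    by rewrite !inE => ->; rewrite ?orbT.
  by apply/setUP; left; apply/setUP; right; apply/set2P; right.
- have -> : t = full finset.set0.
    apply: tE; rewrite ?inE ?mems //; apply: sub_oab => p.
    by rewrite !inE.
  by apply/setUP; left; apply/setUP; left; apply/setUP; right; apply/set2P; right.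
Qed.

End Level.

Lemma degenerate_square_pushout : is_pushout s.
Proof. by apply: extends_pushout => n f; apply: degenerate_extends. Qed.

End DegenerateSquare.

Lemma degenerate_projh_pushout (C : sSet) (g : smap (Delta 1) C) :
  quasicategory C -> is_pushout (scomp g projh).
Proof.
move=> qcatC; have edge (e : 'I_2) k (z : sqJ k) : (forall i, (sq_vertex z i).1 = e) ->
    scomp g projh k z = g k (mconst k e).
  move=> ze; congr (g k _); apply: mono_eq => i; rewrite mconstE; exact: ze.
apply: (@degenerate_square_pushout _ _ true) => // k z z' zv zv'.
- by rewrite !(edge ord_max) // => i; [have := zv' i|have := zv i];
    rewrite !inE => /orP[] /eqP ->.
- by rewrite !(edge ord0) // => i; [have := zv' i|have := zv i];
    rewrite !inE => /orP[] /eqP ->.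
Qed.

Lemma degenerate_projv_pushout (C : sSet) (g : smap (Delta 1) C) :
  quasicategory C -> is_pushout (scomp g projv).
Proof.
move=> qcatC; have edge (e : 'I_2) k (z : sqJ k) : (forall i, (sq_vertex z i).2 = e) ->
    scomp g projv k z = g k (mconst k e).
  move=> ze; congr (g k _); apply: mono_eq => i; rewrite mconstE; exact: ze.
apply: (@degenerate_square_pushout _ _ false) => // k z z' zv zv'.
- by rewrite !(edge ord_max) // => i; [have := zv' i|have := zv i];
    rewrite !inE => /orP[] /eqP ->.
- by rewrite !(edge ord0) // => i; [have := zv' i|have := zv i];
    rewrite !inE => /orP[] /eqP ->.
Qed.

(** * The inner anodyne part of the extension *)

Section Prism.
Variable n : nat.
Notation le := (@vle n).

Definition top_at (k : 'I_n.+1) : vert n := (ord_max, ord_max, k).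

(** The chains of the union of [I x Delta n] and [J x boundary n]. *)
Definition prism_base : {set {set vert n}} :=
  [set s : {set vert n} | chain le s &&
    ([forall p in s, ~~ corner p] || [exists j, forall p in s, p.2 != j])]%SET.

(** The chains that can be reached from [prism_base] by inner horns; the others
    contain a copy of [Delta n], on which the universal property is needed. *)
Definition prism_inner : {set {set vert n}} :=
  [set s : {set vert n} | chain le s && ~~ (corners n \subset s)]%SET.

Lemma prism_base_down : down_closed prism_base.
Proof.
move=> s t st; rewrite !inE => /andP[tc h]; rewrite (chainS st) //=.
have sub := fintype.subsetP st.
case/orP: h => [/forall_inP h|/existsP[j /forall_inP h]]; apply/orP; [left|right].
  by apply/forall_inP => p /sub; apply: h.
by apply/existsP; exists j; apply/forall_inP => p /sub; apply: h.
Qed.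

Lemma prism_inner_down : down_closed prism_inner.
Proof.
move=> s t st; rewrite !inE => /andP[tc h]; rewrite (chainS st) //=.
by apply: contra h => h; apply: fintype.subset_trans h st.
Qed.

(** The pivot of a chain has the level of the lowest corner of the chain, and its
    position in the square is the last one that the chain visits before that level.
    Hence it is comparable with all vertices of the chain, comes after a vertex of
    the level below, and comes before the lowest corner. *)
Definition pivot (s : {set vert n}) (v : vert n) : bool :=
  [&& top_at v.2 \in s,
      [forall q in s, corner q ==> (v.2 <= q.2)],
      [exists p in s, (p.1 == v.1) && (p.2.+1 == v.2)] &
      [forall q in s, (q.2 < v.2) ==> (q.1.1 <= v.1.1) && (q.1.2 <= v.1.2)]].

Lemma pivotP (s : {set vert n}) v : reflect
  [/\ top_at v.2 \in s,
      forall q, q \in s -> corner q -> v.2 <= q.2,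
      exists p, [/\ p \in s, p.1 = v.1 & p.2.+1 = v.2] &
      forall q, q \in s -> q.2 < v.2 -> q.1.1 <= v.1.1 /\ q.1.2 <= v.1.2]
  (pivot s v).
Proof.
apply: (iffP and4P) => [[h1 h2 h3 h4]|[h1 h2 [p [ps p1 p2]] h4]]; split=> //.
- by move=> q qs cq; have /forall_inP/(_ _ qs)/implyP := h2; apply.
- by case/exists_inP: h3 => p ps /andP[/eqP p1 /eqP p2]; exists p.
- by move=> q qs ql; have /forall_inP/(_ _ qs)/implyP/(_ ql)/andP := h4.
- by apply/forall_inP => q qs; apply/implyP; apply: h2.
- by apply/exists_inP; exists p; rewrite // p1 p2 !eqxx.
- by apply/forall_inP => q qs; apply/implyP => /(h4 _ qs)/andP.
Qed.

Lemma pivot_noncorner (s : {set vert n}) v : pivot s v -> ~~ corner v.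
Proof.
case/pivotP=> _ low [p [ps p1 p2]] _; apply/negP => cv.
by have := low _ ps; rewrite /corner p1 => /(_ cv); rewrite -p2 ltnn.
Qed.

Lemma pivotD (s : {set vert n}) v : pivot s v = pivot (s :\ v) v.
Proof.
case cv: (corner v).
  apply/idP/idP => /pivot_noncorner; by rewrite cv.
have neq (p : vert n) : p.2 < v.2 -> p \in s -> p \in s :\ v.
  by move=> lp ps; rewrite !inE ps andbT; apply: contraTneq lp => ->; rewrite ltnn.
have D p : p \in s :\ v -> p \in s by rewrite !inE => /andP[].
apply/pivotP/pivotP => -[h1 h2 [p [ps p1 p2]] h4]; split.
- rewrite !inE h1 andbT; by apply: contraFneq cv => <-; rewrite /corner !eqxx.
- by move=> q /D; apply: h2.
- by exists p; split=> //; apply: neq ps; rewrite -p2.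
- by move=> q /D; apply: h4.
- exact: D.
- move=> q qs cq; apply: h2 => //; rewrite !inE qs andbT.
  by apply: contraFneq cv => <-.
- by exists p; split=> //; apply: D.
- by move=> q qs ql; apply: (h4 q _ ql); apply: neq.
Qed.

Lemma pivot_uniq (s : {set vert n}) u v : pivot s u -> pivot s v -> u = v.
Proof.
move=> /pivotP[ut ul [p [ps p1 p2]] uh] /pivotP[vt vl [q [qs q1 q2]] vh].
have ctop k : corner (top_at k) by rewrite /corner !eqxx.
have uv : u.2 = v.2.
  apply/val_inj/eqP; rewrite eqn_leq.
  by rewrite (ul _ vt (ctop _)) (vl _ ut (ctop _)).
have [h1 h2] : p.1.1 <= v.1.1 /\ p.1.2 <= v.1.2 by apply: vh; rewrite // -uv -p2.
have [h1' h2'] : q.1.1 <= u.1.1 /\ q.1.2 <= u.1.2 by apply: uh; rewrite // uv -q2.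
rewrite p1 in h1 h2; rewrite q1 in h1' h2'.
case: u v {ut ul uh vt vl vh p1 p2 q1 q2} uv h1 h2 h1' h2' =>
  [[a b] c] [[a' b'] c'] /= -> h1 h2 h1' h2'.
by congr (_, _, _); apply/val_inj/eqP; rewrite eqn_leq ?h1 ?h2.
Qed.

Lemma chain_cases (s : {set vert n}) p q : chain le s -> p \in s -> q \in s ->
  le p q \/ le q p.
Proof. by move=> /chainP sc ps qs; apply/orP; apply: sc. Qed.

Lemma not_prism_base (s : {set vert n}) : chain le s -> s \notin prism_base ->
  (exists2 p, p \in s & corner p) /\ forall j, exists2 p, p \in s & p.2 = j.
Proof.
move=> sc; rewrite !inE sc /= negb_or => /andP[/forall_inPn[p ps]].
rewrite negbK => cp /existsPn lev; split; first by exists p.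
move=> j; have /forall_inPn[q qs] := lev j.
by rewrite negbK => /eqP qj; exists q.
Qed.

Lemma corner_top p : corner p -> p = top_at p.2.
Proof. by case: p => [[a b] c] /andP[/eqP /= -> /eqP /= ->]. Qed.

Lemma above_top p k : le (top_at k) p -> corner p.
Proof.
case/and3P=> /= h1 h2 _; rewrite /corner -!(inj_eq val_inj) /=.
by rewrite !eqn_leq h1 h2 !leq_ord.
Qed.

Lemma sum_squeeze (a b c d : nat) :
  a <= c -> b <= d -> c + d <= a + b -> c <= a /\ d <= b.
Proof. by lia. Qed.

Lemma sum_strict (a b c d : nat) :
  a <= c -> b <= d -> ~~ ((a == c) && (b == d)) -> a + b < c + d.
Proof. by lia. Qed.

(** If the lowest corner were at level 0, then every vertex at a higher level
    would lie above it and be a corner, and the chain, which meets all levels,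
    would contain all corners. *)
Lemma pivot_exists (s : {set vert n}) : s \in prism_inner -> s \notin prism_base ->
  exists v, pivot s v.
Proof.
rewrite inE => /andP[sc nc] /(not_prism_base sc)[[p0 p0s cp0] lev].
pose m := [arg min_(p < p0 | (p \in s) && corner p) (p.2 : nat)].
have [ms cm m_min] : [/\ m \in s, corner m &
    forall q, q \in s -> corner q -> m.2 <= q.2].
  rewrite /m; case: arg_minnP => [|p /andP[ps cp] pmin]; first by rewrite p0s.
  by split=> // q qs cq; apply: pmin; rewrite qs.
have m0 : 0 < m.2.
  rewrite lt0n; apply: contra nc => /eqP m0; apply/fintype.subsetP => q.
  rewrite inE => cq; have [p ps pq] := lev q.2.
  have [q0|q0] := posnP q.2.
    rewrite (corner_top cq) (_ : q.2 = m.2) -?(corner_top cm) //.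
    by apply: val_inj; rewrite /= m0.
  rewrite (corner_top cq) -pq -corner_top //.
  have [|/and3P[_ _ pm]] := chain_cases sc ms ps.
    by rewrite (corner_top cm); apply: above_top.
  by move: pm; rewrite m0 leqn0 pq => /eqP qz; rewrite qz in q0.
have [lev_lt lev_eq] : m.2.-1 < n.+1 /\ m.2.-1.+1 = m.2.
  by rewrite prednK //; split=> //; apply/ltnW/ltn_ord.
have [p1 p1s p1l] := lev (Ordinal lev_lt).
pose wt (p : vert n) := p.1.1 + p.1.2.
pose p := [arg max_(p > p1 | (p \in s) && (p.2.+1 == m.2)) wt p].
have [ps pl p_max] : [/\ p \in s, p.2.+1 = m.2 &
    forall q, q \in s -> q.2.+1 = m.2 -> wt q <= wt p].
  rewrite /p; case: arg_maxnP => [|q /andP[qs /eqP ql] qmax].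
    by rewrite p1s p1l /= lev_eq eqxx.
  by split=> // r rs rl; apply: qmax; rewrite rs rl eqxx.
exists (p.1, m.2); apply/pivotP; split=> /=.
- by rewrite -corner_top.
- exact: m_min.
- by exists p.
- move=> q qs; rewrite -pl ltnS => ql.
  have [/and3P[h1 h2 h3]|/and3P[h1 h2 _]] := chain_cases sc ps qs; last by split.
  have := p_max _ qs; rewrite -pl /wt (_ : q.2 = p.2); last first.
    by apply/val_inj/eqP; rewrite eqn_leq ql.
  by move=> /(_ erefl); apply: sum_squeeze.
Qed.

Lemma pivot_toggle (s : {set vert n}) v :
  s \in prism_inner -> s \notin prism_base -> pivot s v ->
  [/\ v |: s \in prism_inner, s :\ v \notin prism_base,
      exists p, [/\ p \in s, p != v & le p v] &
      exists q, [/\ q \in s, q != v & le v q]].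
Proof.
rewrite inE => /andP[sc nc] sN sv.
have [[p0 p0s cp0] lev] := not_prism_base sc sN.
have vc := pivot_noncorner sv.
have [vt vlow [p [ps p1 p2]] vhigh] := pivotP _ _ sv.
have tv : top_at v.2 != v by apply: contraNneq vc => <-; rewrite /corner !eqxx.
have v_cmp q : q \in s -> le v q || le q v.
  move=> qs; apply/orP; case: (ltnP q.2 v.2) => ql; [right|left].
    by have [h1 h2] := vhigh _ qs ql; rewrite /vle h1 h2 ltnW.
  have [/and3P[]|/and3P[_ _]] := chain_cases sc ps qs.
    by rewrite p1 /vle => -> ->.
  by rewrite leqNgt p2 ql.
split.
- rewrite inE; apply/andP; split.
    apply/chainP => q r; rewrite !inE => /orP[/eqP ->|qs] /orP[/eqP ->|rs].
    + by rewrite vle_refl.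
    + exact: v_cmp.
    + by rewrite orbC v_cmp.
    + exact: (chainP _ _ sc).
  apply: contra nc => /fintype.subsetP cs; apply/fintype.subsetP => q cq.
  have := cs _ cq; rewrite !inE => /orP[/eqP qv|//].
  by rewrite inE qv (negPf vc) in cq.
- rewrite inE (chainS (finset.subsetDl _ _) sc) /= negb_or; apply/andP; split.
    apply/forall_inPn; exists p0; rewrite ?negbK // !inE p0s andbT.
    by apply: contraNneq vc => <-.
  apply/existsPn => j; have [q qs ql] := lev j.
  apply/forall_inPn; have [qv|qv] := eqVneq q v.
    by exists (top_at v.2); rewrite ?negbK ?inE ?tv // -ql qv.
  by exists q; rewrite ?negbK ?ql // !inE qv.
- exists p; split=> //.
    by apply/eqP => pv; move: p2; rewrite pv => /eqP; rewrite gtn_eqF.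
  by rewrite /vle p1 !leqnn -p2 leqnSn.
- by exists (top_at v.2); rewrite /vle /= !leq_ord leqnn.
Qed.

(** Corners weigh more than all other vertices, and the weight is otherwise
    strictly monotone in the position; the level does not count. *)
Definition prism_weight (p : vert n) : nat := (p.1.1 + p.1.2).+1.

(** If [w] is a corner, then the new pivot is not one and is lighter. If [w] is
    the vertex that determines the position of [v], then the new position is
    strictly below that of [w]. In all other cases the pivot does not change. *)
Lemma pivot_descend (s : {set vert n}) v w u :
  s \in prism_inner -> s \notin prism_base -> pivot s v -> v \in s -> w \in s ->
  w != v -> s :\ w \notin prism_base -> pivot (s :\ w) u ->
  u \in s :\ w \/ prism_weight u < prism_weight w.
Proof.
rewrite inE => /andP[sc nc] sN sv vs ws wv swN swu.
have uc := pivot_noncorner swu.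
have u_lt2 : u.1.1 + u.1.2 < 2.
  have := ltn_ord u.1.1; have := ltn_ord u.1.2; rewrite !ltnS.
  move: uc; rewrite /corner -!(inj_eq val_inj) /=; lia.
case cw: (corner w).
  by right; rewrite (corner_top cw) /prism_weight ltnS.
have [ut ulow [p [ps p1 p2]] uhigh] := pivotP _ _ swu.
have [vt vlow [q [qs q1 q2]] vhigh] := pivotP _ _ sv.
have ctop k : corner (top_at k) by rewrite /corner !eqxx.
have in_sw r : r \in s -> r != w -> r \in s :\ w by move=> rs rw; rewrite !inE rs rw.
have sw_in r : r \in s :\ w -> r \in s by rewrite !inE => /andP[].
have uv : u.2 = v.2.
  apply/val_inj/eqP; rewrite eqn_leq (vlow _ (sw_in _ ut) (ctop _)) andbT.
  by apply: ulow (ctop v.2); apply: in_sw => //; apply: contraFneq cw => <-.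
have [h1 h2] : p.1.1 <= v.1.1 /\ p.1.2 <= v.1.2.
  by apply: vhigh; rewrite ?sw_in // -uv -p2.
rewrite p1 in h1 h2.
have [qw|qw] := eqVneq q w.
  right; rewrite -qw /prism_weight q1.
  have : u.1 != v.1.
    apply: contraTneq ps => uv1; rewrite inE negb_and negbK.
    have -> // : p = w by rewrite -qw; apply: injective_projections;
      [rewrite p1 uv1 q1|apply: val_inj; apply: succn_inj; rewrite p2 q2 uv].
    by rewrite inE eqxx.
  case: (u.1) (v.1) h1 h2 => [a b] [a' b'] /= h1 h2; rewrite xpair_eqE -!(inj_eq val_inj).
  by rewrite ltnS; apply: sum_strict.
left; have [h1' h2'] : q.1.1 <= u.1.1 /\ q.1.2 <= u.1.2.
  by apply: uhigh; rewrite ?in_sw // uv -q2.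
rewrite q1 in h1' h2'; suff -> : u = v by rewrite !inE eq_sym wv.
case: u v h1 h2 h1' h2' uv {swu sv uc u_lt2 ut ulow uhigh vt vlow vhigh
  p1 p2 q1 q2 vs wv} => [[a b] c] [[a' b'] c'] /= h1 h2 h1' h2' ->.
by congr (_, _, _); apply/val_inj/eqP; rewrite eqn_leq ?h1 ?h2.
Qed.

Lemma extend_prism (C : sSet) (f : pmap (vert n) C) : quasicategory C ->
  natural_on le prism_base f ->
  exists f', natural_on le prism_inner f' /\ agree le prism_base f' f.
Proof.
move=> qcatC fB.
apply: (extend_matching (@vle_refl _) (@vle_anti _) (@vle_trans _)
  (piv := pivot) (wt := prism_weight) qcatC prism_base_down prism_inner_down fB) => //.
- by move=> s; rewrite inE => /andP[].
- exact: pivot_exists.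
- by move=> s u v _ _; apply: pivot_uniq.
- exact: pivotD.
- exact: pivot_toggle.
- exact: pivot_descend.
Qed.

End Prism.

(** * Restriction to the span lifts against boundaries *)

Lemma vertex_point (X : sSet) (x : X 0) i : vertex x i = x.
Proof. by rewrite -[RHS]act_id (mono0E (mid 0)) /vertex (ord1 i). Qed.

Section ResPoFill.
Variables (C : sSet) (cof : C 1 -> Prop).
Hypothesis qcatC : quasicategory C.

Section Positive.
Variables (n : nat) (x : expI_co cof n.+1)
  (b : smap (sub (boundary n.+1)) (expJ_co_po cof)).
Hypothesis bx : forall k (d : sub (boundary n.+1) k),
  res_po cof k (b k d) = act (sval d) x.

Definition span_map : smap (sprod spanI (Delta n.+1)) C := sval x.

Definition face_map k (d : sub (boundary n.+1) k) : smap (sprod sqJ (Delta k)) C :=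
  sval (sval (b k d)).

Lemma face_span k (d : sub (boundary n.+1) k) l (i : spanI l) (e : mono l k) :
  face_map d l (inclI l i, e) = span_map l (i, mcomp (sval d) e).
Proof.
exact: (congr1 (fun y : expI_co cof k =>
  (sval y : smap (sprod spanI (Delta k)) C) l (i, e)) (bx d)).
Qed.

Lemma face_act m k (g : mono m k) (d : sub (boundary n.+1) k) l (z : sqJ l)
    (e : mono l m) :
  face_map (act g d) l (z, e) = face_map d l (z, mcomp g e).
Proof. by rewrite /face_map sfun_act. Qed.

Lemma vertex0_boundary k : boundary n.+1 k (mconst k ord0).
Proof. by exists ord_max => i; rewrite mconstE. Qed.

(** The common extension of the simplex of diagrams on [I] and the sphere of
    squares on [J]; outside of their union its value is arbitrary. *)
Definition union_map k (z : sprod sqJ (Delta n.+1) k) : C k :=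
  if pselect (spanI_subset k z.1) is left h then
    span_map k (exist _ z.1 h, z.2)
  else if pselect (boundary n.+1 k z.2) is left h then
    face_map (exist _ z.2 h) k (z.1, mid k)
  else face_map (exist _ _ (vertex0_boundary k)) k (z.1, mid k).

Lemma union_map_span k (i : spanI k) (e : mono k n.+1) :
  union_map ((inclI k i, e) : sprod sqJ (Delta n.+1) k) = span_map k (i, e).
Proof.
rewrite /union_map; case: pselect => [h|[]]; last exact: svalP i.
by congr (span_map k (_, _)); apply: sig_eq.
Qed.

Lemma union_map_face k (z : sqJ k) (d : sub (boundary n.+1) k) :
  union_map ((z, sval d) : sprod sqJ (Delta n.+1) k) = face_map d k (z, mid k).
Proof.
rewrite /union_map; case: pselect => [h|nh].
  by rewrite -[z in RHS]/(inclI k (exist _ z h)) face_span mcomp1.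
case: pselect => [h|[]]; last exact: svalP d.
by congr (face_map _ k _); apply: sig_eq.
Qed.

Lemma union_map_face_comp k (d : sub (boundary n.+1) k) l (z : sqJ l) (e : mono l k) :
  union_map ((z, mcomp (sval d) e) : sprod sqJ (Delta n.+1) l) = face_map d l (z, e).
Proof.
rewrite (union_map_face z (act e d)) face_act; congr (face_map d l (z, _)).
exact: mcomp1.
Qed.

Lemma union_map_act m k (g : mono m k) (z : sprod sqJ (Delta n.+1) k) :
  spanI_subset k z.1 \/ boundary n.+1 k z.2 ->
  union_map (act g z) = act g (union_map z).
Proof.
case: z => z e [/= zI|/= eB].
  rewrite (union_map_span (exist _ z zI)) -sfun_act.
  exact: (union_map_span (act g (exist _ z zI : spanI k))).
rewrite (union_map_face z (exist _ e eB)) -sfun_act.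
rewrite [LHS](union_map_face_comp (exist _ e eB)); congr (face_map _ m (_, _)).
by apply: mono_eq => i; rewrite !mcompE !midE.
Qed.

Lemma prism_baseP k (w : 'I_k.+1 -> vert n.+1) :
  in_family (@vle _) (prism_base n.+1) w ->
  spanI_subset k (simplex_of w).1 \/ boundary n.+1 k (simplex_of w).2.
Proof.
move=> [wm]; rewrite inE => /andP[_ /orP[/forall_inP h|/existsP[j /forall_inP h]]].
  left=> i; rewrite /= !tomonoE; try by move=> i' j' /wm/and3P[].
  case=> w1 w2; have := h _ (mem_trace w i).
  by rewrite /corner w1 w2 !eqxx.
right; exists j => i; rewrite /= tomonoE; last by move=> i' j' /wm/and3P[].
exact/eqP/(h _ (mem_trace w i)).
Qed.

Lemma in_prism_base k (z : sprod sqJ (Delta n.+1) k) :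
  spanI_subset k z.1 \/ boundary n.+1 k z.2 ->
  in_family (@vle _) (prism_base n.+1) (vertices z).
Proof.
move=> zB; split; first exact: vertices_increasing.
rewrite inE chain_trace /=; last exact: vertices_increasing.
apply/orP; case: zB => [zI|[j zj]]; [left|right].
  by apply/forall_inP => _ /traceP[i ->]; apply/andP => -[/eqP h1 /eqP h2]; apply: (zI i).
by apply/existsP; exists j; apply/forall_inP => _ /traceP[i ->]; apply/eqP/zj.
Qed.

(** After the inner horns of [extend_prism], what remains is the extension problem
    of [pushout_extends] for the square over the vertex 0 of the sphere. *)
Lemma union_extends : exists y : smap (sprod sqJ (Delta n.+1)) C,
  forall k (z : sprod sqJ (Delta n.+1) k),
  spanI_subset k z.1 \/ boundary n.+1 k z.2 -> y k z = union_map z.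
Proof.
pose f0 : pmap (vert n.+1) C := fun k w => union_map (simplex_of w).
have f0B : natural_on (@vle _) (prism_base n.+1) f0.
  move=> m k g w wB; case: (wB) => wm _; rewrite /f0 simplex_of_comp //.
  exact/union_map_act/prism_baseP.
have [f1 [f1K f10]] := extend_prism qcatC f0B.
have base_inner : prism_base n.+1 \subset prism_inner n.+1.
  apply/fintype.subsetP => s; rewrite !inE => /andP[-> ].
  case/orP=> [/forall_inP h|/existsP[j /forall_inP h]] /=.
    apply/subsetPn; exists (top_at ord0); first by rewrite inE /corner !eqxx.
    by apply/negP => /h; rewrite /corner !eqxx.
  apply/subsetPn; exists (top_at j); first by rewrite inE /corner !eqxx.
  by apply/negP => /h; rewrite eqxx.
pose v0 : sub (boundary n.+1) 0 := exist _ _ (vertex0_boundary 0).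
pose s : smap sqJ C := diagram (face_map v0 : exp sqJ C 0).
have s_po : is_pushout s.
  have : is_pushout (diagram (sval (vertex (sval (b 0 v0)) ord0))) :=
    svalP (b 0 v0) ord0.
  by rewrite vertex_point.
have f1s : based s f1.
  move=> k z; have zB : boundary n.+1 k (mconst k ord0) := vertex0_boundary k.
  rewrite f10; last by apply: in_prism_base; right.
  rewrite /f0 verticesK.
  rewrite -[mconst k ord0 in LHS](mcomp_const ord0 (mconst k (ord0 : 'I_1))).
  exact: (union_map_face_comp v0).
have f1J : natural_on (@vle _) (joinK_boundary n.+1) f1.
  move=> m k g w [wm]; rewrite inE => /andP[_ wc]; apply: f1K; split=> //.
  by rewrite inE chain_trace.
have [f2 [f2J f21]] := pushout_extends s_po f1J f1s.
have [|f3 [f3U f31 _]] := glue (@prism_inner_down _) (@joinK_down _) f1K f2J.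
  move=> k w [wm]; rewrite !inE => /andP[/andP[_ wc] wJ].
  by rewrite f21 //; split=> //; rewrite !inE wJ wc.
have all_in k (z : sprod sqJ (Delta n.+1) k) :
    in_family (@vle _) (prism_inner n.+1 :|: joinK n.+1) (vertices z).
  have zm := vertices_increasing z; split=> //.
  have zc := chain_trace zm; apply/setUP.
  have [cs|ncs] := boolP (corners n.+1 \subset trace (vertices z)); last first.
    by left; rewrite inE zc.
  right; rewrite inE; apply/forall_inP => p pz.
  have t0 : top_at ord0 \in trace (vertices z).
    by apply: (fintype.subsetP cs); rewrite inE /corner !eqxx.
  apply/orP; have [/above_top|/and3P[_ _]] := chain_cases zc t0 pz; first by left.
  by rewrite leqn0 => p0; right.
have yact m k (g : mono m k) (z : sprod sqJ (Delta n.+1) k) :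
    f3 m (vertices (act g z)) = act g (f3 k (vertices z)).
  by rewrite vertices_act f3U.
exists (@SMap (sprod sqJ (Delta n.+1)) C (fun k z => f3 k (vertices z)) yact).
move=> k z /in_prism_base zB /=; rewrite f31; last exact: in_familyS zB.
by rewrite f10 // /f0 verticesK.
Qed.

Lemma res_po_fill_pos : exists y : expJ_co_po cof n.+1, res_po cof n.+1 y = x /\
  forall k (d : sub (boundary n.+1) k), act (sval d) y = b k d.
Proof.
have [y yU] := union_extends.
have yI : exp_pre C inclI n.+1 (y : exp sqJ C n.+1) = sval x.
  apply: smap_eq => k [i e] /=; rewrite yU; first exact: union_map_span.
  by left; apply: svalP i.
have yco : expJ_co_subset cof n.+1 y.
  move=> i; have := svalP x i; rewrite -yI vertex_sfun.
  by [].
have yd k (d : sub (boundary n.+1) k) : act (sval d) (y : exp sqJ C n.+1) = face_map d.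
  apply: smap_eq => l [z e] /=; rewrite yU; first exact: union_map_face_comp.
  by right; apply: mem_act (svalP d).
pose yco' : expJ_co cof n.+1 := exist _ y yco.
have ypo : expJ_co_po_subset cof n.+1 yco'.
  move=> i; pose vi : sub (boundary n.+1) 0 := exist _ _ (boundary_vertex i).
  have : is_pushout (diagram (sval (vertex (sval (b 0 vi)) ord0))) :=
    svalP (b 0 vi) ord0.
  by rewrite vertex_point -[sval (sval _)]/(face_map vi) -yd.
exists (exist _ yco' ypo); split; first by apply: sig_eq.
by move=> k d; apply: sig_eq; apply: sig_eq; apply: yd.
Qed.

End Positive.
Lemma res_po_fill_point (x : expI_co cof 0) : pushouts_along_cof cof ->
  exists y : expJ_co_po cof 0, res_po cof 0 y = x.
Proof.
move=> poC; have xco : cof (left_map (diagram (sval x))).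
  have : cof (left_map (diagram (vertex (sval x) ord0))) := svalP x ord0.
  by rewrite vertex_point.
have [s [sx s_po]] := poC _ xco.
pose y : exp sqJ C 0 := scomp s (sfst sqJ (Delta 0)).
have ys : diagram y = s by apply: smap_eq.
have yco : expJ_co_subset cof 0 y by move=> i; rewrite vertex_point ys sx.
pose yco' : expJ_co cof 0 := exist _ y yco.
have ypo : expJ_co_po_subset cof 0 yco' by move=> i; rewrite vertex_point /= ys.
exists (exist _ yco' ypo); apply: sig_eq; apply: smap_eq => k [i e] /=.
rewrite -[s k _]/(scomp s inclI k i) sx /=; congr (sval x k (i, _)).
by rewrite [RHS]mono0E.
Qed.

Lemma res_po_fill : pushouts_along_cof cof ->
  forall n (x : expI_co cof n) (b : smap (sub (boundary n)) (expJ_co_po cof)),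
  (forall k (d : sub (boundary n) k), res_po cof k (b k d) = act (sval d) x) ->
  exists y : expJ_co_po cof n, res_po cof n y = x /\
    forall k (d : sub (boundary n) k), act (sval d) y = b k d.
Proof.
move=> poC [|n] x b bx; last exact: res_po_fill_pos bx.
have [y yx] := res_po_fill_point x poC; exists y; split=> // k [d [j dj]].
by case: (dj ord0); rewrite !ord1.
Qed.

End ResPoFill.

Section IdExt.
Variables (C : sSet) (cof : C 1 -> Prop) (idC : identities_cof cof).
Hypothesis qcatC : quasicategory C.

Lemma id_ext_restrict n (x : expI_Id idC n) :
  exp_pre C inclI n (id_ext idC n x) = sval (sval x).
Proof.
case: x => x [[f fx]|[g gx]].
- by subst x; rewrite id_ext_left_id; apply: smap_eq.
- by subst x; rewrite id_ext_top_id; apply: smap_eq.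
Qed.

Lemma id_ext_co n (x : expI_Id idC n) : expJ_co_subset cof n (id_ext idC n x).
Proof.
move=> i; have := svalP (sval x) i; rewrite -id_ext_restrict vertex_sfun.
by [].
Qed.

(** The vertices of [id_ext] are identity squares, which are pushouts by
    [degenerate_square_pushout]. *)
Lemma id_ext_po n (x : expI_Id idC n) :
  expJ_co_po_subset cof n (exist _ (id_ext idC n x) (id_ext_co x) : expJ_co cof n).
Proof.
move=> i; change (is_pushout (diagram (vertex (id_ext idC n x) i))).
case: x => x [[f fx]|[g gx]]; subst x.
- rewrite id_ext_left_id vertex_sfun.
  rewrite (_ : diagram _ = scomp (diagram (vertex f i)) projh).
    exact: degenerate_projh_pushout.
  exact: smap_eq.
- rewrite id_ext_top_id vertex_sfun.
  rewrite (_ : diagram _ = scomp (diagram (vertex (sval g) i)) projv).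
    exact: degenerate_projv_pushout.
  exact: smap_eq.
Qed.

Definition id_ext_lift : smap (expI_Id idC) (expJ_co_po cof).
Proof.
refine (@SMap (expI_Id idC) (expJ_co_po cof)
  (fun n x => exist _ (exist _ (id_ext idC n x) (id_ext_co x)) (@id_ext_po n x)) _).
by move=> m n f x; apply: sig_eq; apply: sig_eq; apply: id_ext_act.
Defined.

End IdExt.

Theorem proposition3p29 (C : sSet) (cof : C 1 -> Prop)
    (qcatC : quasicategory C)
    (poC : pushouts_along_cof cof)
    (idC : identities_cof cof) :
  exists F : smap (expI_co cof) (expJ_co_po cof),
    scomp (res_po cof) F = sid (expI_co cof) /\
    scomp (expJ_co_po_incl cof) (scomp F (sub_incl (expI_Id_subset idC)))
      = id_ext idC.
Proof.
have lift_res : scomp (res_po cof) (id_ext_lift idC qcatC) =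
    sub_incl (expI_Id_subset idC).
  by apply: smap_eq => n x; apply: sig_eq; apply: id_ext_restrict.
have [F [Fres FId]] := section_extension lift_res (res_po_fill qcatC poC).
by exists F; split=> //; rewrite FId; apply: smap_eq.
Qed.
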